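(* Let $a>0$, $a\ne1$. There is a constant $C'(a)>0$ depending only on $a$ such that the following holds. Let $T>0$, let $y\neq 0$ be real, let $g\in L^2(\mathbb{R})$ with $\|g\|_{L^2}=1$, and let $\varphi\in C_0^\infty(\mathbb{R})$ satisfy $0\le\varphi$ and $\varphi^2(t)\le\chi_{[T,2T]}(t)$. Choose initial data $u_0$ with $$\widehat{u_0}(\xi)=|\xi|^{a-1}\,\widehat{g\varphi}(y\xi+|\xi|^a),$$ and let $u(t,x)=e^{it|D|^a}u_0(x)$. Then $$\left(\int_T^{2T}|u(t,yt)|^2\,dt\right)^{1/2}\ge C'(a)\,|y|^{\frac{a}{4(a-1)}}\,C(g)\,\|u_0\|_{\dot H^{(1-a)/2}},$$ where $C(g)\ge0$ is given by $$C(g)^2=\begin{cases}\displaystyle\int_0^{(a-1)|y/a|^{a/(a-1)}}|\zeta|^{-1/2}\left|\widehat{g\varphi}\left(\zeta-(a-1)|y/a|^{a/(a-1)}\right)\right|^2d\zeta, & a>1,\\[2ex] \displaystyle\int_{(a-1)|y/a|^{a/(a-1)}}^0|\zeta|^{-1/2}\left|\widehat{g\varphi}\left(\zeta+(1-a)|y/a|^{a/(a-1)}\right)\right|^2d\zeta, & 0<a<1.\end{cases}$$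
   Context: $u=e^{it|D|^a}u_0$ is the solution on $\mathbb{R}_t\times\mathbb{R}_x$ of $\partial_t u-i|D|^a u=0$, $u(0,x)=u_0(x)$, given by $u(t,x)=\int e^{i(x\xi+t|\xi|^a)}\widehat{u_0}(\xi)\,d\xi$ (normalization constants of the Fourier transform are absorbed in $C'(a)$), with $\widehat{f}(\tau)=\int e^{-it\tau}f(t)\,dt$. $\|f\|_{\dot H^s}=\left(\int|\xi|^{2s}|\widehat f(\xi)|^2d\xi\right)^{1/2}$. $\chi_{[T,2T]}$ is the indicator function of $[T,2T]$. *)

(* Defs.v *)
From HB Require Import structures.
From mathcomp Require Import all_boot all_order all_algebra.
From mathcomp Require Import complex.
From mathcomp Require Import all_classical all_reals all_analysis.

Set Implicit Arguments.
Unset Strict Implicit.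
Unset Printing Implicit Defensive.
Import Order.TTheory GRing.Theory Num.Theory.
Import numFieldNormedType.Exports.

Local Open Scope classical_set_scope.
Local Open Scope ring_scope.

Local Notation leb := (@lebesgue_measure _).

Definition expi (R : realType) (theta : R) : R[i] :=
  Complex (cos theta) (sin theta).

Definition cmodulus (R : realType) (z : R[i]) : R := ComplexField.Normc.normc z.

Definition cmeasurable (R : realType) (D : set R) (f : R -> R[i]) : Prop :=
  measurable_fun D (fun t => complex.Re (f t)) /\
  measurable_fun D (fun t => complex.Im (f t)).

(* Meaningful only if f is Lebesgue integrable on D: Rintegral is total. *)
Definition cintegral (R : realType) (D : set R) (f : R -> R[i]) : R[i] :=
  Complex (Rintegral leb D (fun t => complex.Re (f t)))
          (Rintegral leb D (fun t => complex.Im (f t))).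

Definition L2norm (R : realType) (D : set R) (f : R -> R[i]) : \bar R :=
  ((\int[leb]_(t in D) (cmodulus (f t) ^+ 2)%:E) `^ 2^-1)%E.

Definition fourier (R : realType) (f : R -> R[i]) (tau : R) : R[i] :=
  cintegral setT (fun t => expi (- (t * tau)) * f t).

(* The homogeneous Sobolev norm of f, in terms of fhat, its Fourier transform. *)
Definition hdot_norm (R : realType) (s : R) (fhat : R -> R[i]) : \bar R :=
  ((\int[leb]_(xi in setT)
      (`|xi| `^ (2 * s) * cmodulus (fhat xi) ^+ 2)%:E) `^ 2^-1)%E.

Definition test_function (R : realType) (phi : R -> R) : Prop :=
  (forall n x, derivable (derive1n n phi) x 1) /\
  compact (closure [set t | phi t != 0]).

(* e^{it|D|^a} u0 at (t, x) with frequencies restricted to [-r, r], where u0hat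
   is the Fourier transform of u0.  *)
Definition propagator_cut (R : realType) (a : R) (u0hat : R -> R[i])
    (r t x : R) : R[i] :=
  cintegral `[- r, r] (fun xi => expi (x * xi + t * `|xi| `^ a) * u0hat xi).

(* v is (a representative of) t |-> u(t, y t) on [T, 2T], u = e^{it|D|^a} u0.
   The integral over all frequencies defining u(t, x) need not converge
   absolutely for u0 in a homogeneous Sobolev space, so it is read, as for the
   Fourier transform on L^2, as the L^2-limit of its truncations along the
   line.  If u0hat is integrable this is the absolutely convergent integral,
   for almost every t. *)
Definition trace_on_line (R : realType) (a : R) (u0hat : R -> R[i]) (T y : R)
    (v : R -> R[i]) : Prop :=
  cmeasurable `[T, 2 * T] v /\
  L2norm `[T, 2 * T] (fun t => propagator_cut a u0hat r t (y * t) - v t)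
    @[r --> +oo] --> 0%E.

(* C(g)^2, with f = g phi. *)
Definition Cg_sq (R : realType) (a y : R) (f : R -> R[i]) : \bar R :=
  if 1 < a then
    (\int[leb]_(z in `[0%R, ((a - 1) * `|y / a| `^ (a / (a - 1)))%R])
      (`|z| `^ (- 2^-1) *
       cmodulus (fourier f (z - (a - 1) * `|y / a| `^ (a / (a - 1)))) ^+ 2)%:E)%E
  else
    (\int[leb]_(z in `[((a - 1) * `|y / a| `^ (a / (a - 1)))%R, 0%R])
      (`|z| `^ (- 2^-1) *
       cmodulus (fourier f (z + (1 - a) * `|y / a| `^ (a / (a - 1)))) ^+ 2)%:E)%E.

Definition Cg (R : realType) (a y : R) (f : R -> R[i]) : \bar R :=
  (Cg_sq a y f `^ 2^-1)%E.

(* Main.v *)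
(* Write f = g phi, F for its Fourier transform, k(xi) = y xi + |xi|^a, and
   <w, f> for the real L2 pairing on [T, 2T].  By Fubini, testing a truncation of
   u(t, yt) against f gives

     < cut_r, f > = int_{|xi| <= r} |xi|^(a-1) |F(k(xi))|^2 dxi,

   whose limit is the square of the homogeneous Sobolev norm of u0.  As
   ||f|| <= 1, that square is at most the L2 norm of the trace, so it remains to
   bound C' |y|^(a/(4(a-1))) C(g) by the Sobolev norm itself.  For this, restrict
   the frequencies to the interval between the critical point of k and its
   nonzero root, substitute zeta = k(xi) + Z with - Z the critical value, and use
   that on this interval k'(xi)^2 is at most a constant times |zeta|.

   The trace exists by duality.  For large r < r', pair the increment
   w = cut_r' - cut_r with itself: with W the Fourier transform of w on [T, 2T],
   the integrand is |xi|^(a-1) Re (F conj W)(k(xi)), where |xi|^(a-1) is at most a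
   constant times |k'(xi)|.  Cauchy-Schwarz and the substitution eta = k(xi)
   bound ||w||^2 by the L2 norms of F on the tail and of W, and the latter is
   controlled by ||w|| itself.  The only Plancherel-type fact needed is that the
   Fourier transform is bounded in L2 on functions supported in an interval of
   length L; it follows from Bessel's inequality for the exponentials of
   frequencies theta + 2 pi n / L, integrated over theta. *)

Require Import Defs.
From HB Require Import structures.
From mathcomp Require Import all_boot all_order all_algebra.
From mathcomp Require Import complex.
From mathcomp Require Import all_classical all_reals all_analysis.
From mathcomp Require Import measurable_realfun.
From mathcomp Require Import ring lra.

Set Implicit Arguments.
Unset Strict Implicit.
Unset Printing Implicit Defensive.
Import Order.TTheory GRing.Theory Num.Theory.
Import numFieldNormedType.Exports.

Local Open Scope classical_set_scope.
Local Open Scope ring_scope.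

(** * Fubini's theorem for bounded kernels *)

Section kernel.
Context (R : realType).
Notation mu := (@lebesgue_measure R).
Implicit Types (k u p : R -> R) (K : R -> R -> R).

(** The obstacle is that |xi|^(a-1) is bounded by a multiple of |k'| only at high frequency, since
    k' vanishes at the critical point. Duality therefore controls increments beyond some radius;
    below it absolute integrability suffices, as |xi|^(a-1) is integrable at 0 for a > 0. Cutting at
    xi = 0 reduces everything to s = |xi| and the phase b s + s^a with b = y or b = -y; the critical
    point lies on the half-line where b = -|y|. The cases a > 1 and a < 1 differ by the sign e of a
    - 1, which makes the shifted phase increase from 0 to |Z|. The power of y is a scaling fact.
    Between the critical point s0 and the root, the amplitude is comparable to |y| and k'' to |y| /
    s0, so |k'| is at most a multiple of (|y| |zeta| / s0)^(1/2), and amplitude / |k'| is at least a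
    multiple of (|y| s0)^(1/2) |zeta|^(-1/2). As |y| s0 is a constant times |y|^(a/(a-1)), the
    energy gets the power a/(2(a-1)) and its square root a/(4(a-1)). Cauchy-Schwarz enters as AM-GM
    under the integral sign, so that only linearity and monotonicity of real integrals are used. *)

Lemma integrable_le1M k u (D : set R) : measurable D -> measurable_fun D k ->
  (forall s, `|k s| <= 1) ->
  mu.-integrable D (EFin \o u) -> mu.-integrable D (EFin \o (fun s => k s * u s)).
Proof.
move=> mD mk k1 iu.
have mu_ : measurable_fun D u by apply/measurable_EFinP; case/integrableP: iu.
apply: le_integrable iu => //.
  by apply/measurable_EFinP; apply: measurable_funM.
move=> s _; rewrite /= lee_fin normrM -[leRHS]mul1r.
by apply: ler_wpM2r.
Qed.

Section fubini.
Variables (K : R -> R -> R) (u p : R -> R).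
Hypothesis mK : measurable_fun setT (fun z : R * R => K z.1 z.2).
Hypothesis K1 : forall t s, `|K t s| <= 1.
Hypothesis iu : mu.-integrable setT (EFin \o u).
Hypothesis ip : mu.-integrable setT (EFin \o p).

Let mKl t : measurable_fun setT (K t).
Proof.
have -> : K t = (fun z : R * R => K z.1 z.2) \o (fun s => (t, s)) by [].
by apply: measurableT_comp => //; exact: pair1_measurable.
Qed.

Let mKr s : measurable_fun setT (K ^~ s).
Proof.
have -> : K ^~ s = (fun z : R * R => K z.1 z.2) \o (fun t => (t, s)) by [].
by apply: measurableT_comp => //; exact: pair2_measurable.
Qed.

Let f (z : R * R) := (K z.1 z.2 * u z.2 * p z.1)%:E.

Let m_u : measurable_fun setT u.
Proof. by apply/measurable_EFinP; case/integrableP: iu. Qed.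
Let m_p : measurable_fun setT p.
Proof. by apply/measurable_EFinP; case/integrableP: ip. Qed.

Let mf : measurable_fun setT f.
Proof.
apply/measurable_EFinP; apply: measurable_funM; first apply: measurable_funM => //.
- exact: measurableT_comp.
- exact: measurableT_comp.
Qed.

Let mfl (t : R) : measurable_fun setT (fun s => f (t, s)).
Proof.
apply/measurable_EFinP => /=.
exact: (measurable_funM (measurable_funM (mKl t) m_u) (measurable_cst _)).
Qed.

Let if_ : (mu \x mu)%E.-integrable setT f.
Proof.
apply: (integrable12ltyP mu mu mf).2.
have /integrableP[_ Iu] := iu.
have /integrableP[_ Ip] := ip.
apply: (@le_lt_trans _ _ (\int[mu]_t (`|(p t)%:E| * \int[mu]_s `|(u s)%:E|))%E).
  apply: ge0_le_integral => //.
  - move=> x _; exact: integral_ge0.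
  - apply: (@measurable_fun_fubini_tonelli_F _ _ _ _ _ mu (abse \o f)) => //=.
    exact: measurableT_comp.
  - apply: emeasurable_funM => //; do 2 apply: measurableT_comp => //.
  - move=> t _; rewrite -ge0_integralZl//; last first.
      by do 2 apply: measurableT_comp => //.
    apply: ge0_le_integral => //.
    + exact: (measurableT_comp _ (mfl t)).
    + by apply/measurable_EFinP; apply: measurable_funM => //; apply: measurableT_comp.
    + move=> s _; rewrite /f /= lee_fin !normrM mulrC ler_wpM2l//.
      by rewrite -[leRHS]mul1r ler_wpM2r.
rewrite ge0_integralZr//; last 2 first.
  by do 2 apply: measurableT_comp => //.
  by apply: integral_ge0.
by rewrite lte_mul_pinfty// ?integral_ge0// ge0_fin_numE ?integral_ge0.
Qed.

Lemma integrable_kernel t : mu.-integrable setT (EFin \o (fun s => K t s * u s)).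
Proof. exact: integrable_le1M. Qed.

(** Tonelli's measurability statement concerns nonnegative integrands, hence the detour through the
    positive and negative parts of the integrand, whose integrals are finite. *)
Lemma measurable_kernel : measurable_fun setT (fun t => \int[mu]_s (K t s * u s)).
Proof.
pose h (z : R * R) := (K z.1 z.2 * u z.2)%:E.
have mh : measurable_fun setT h.
  by apply/measurable_EFinP; apply: measurable_funM => //; exact: measurableT_comp.
have hE t : (\int[mu]_s (K t s * u s))%:E =
   (\int[mu]_s h^\+ (t, s) - \int[mu]_s h^\- (t, s))%E.
  rewrite fineK; last exact/integrable_fin_num/integrable_kernel.
  rewrite [LHS]integralE; congr (_ - _)%E; apply: eq_integral => s _; rewrite ?funeposE ?funenegE //.
apply/measurable_EFinP; under [X in measurable_fun _ X]eq_fun do rewrite /= hE.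
apply: emeasurable_funB.
- by apply: (@measurable_fun_fubini_tonelli_F _ _ _ _ _ mu h^\+%E) => //; exact: measurable_funepos.
- by apply: (@measurable_fun_fubini_tonelli_F _ _ _ _ _ mu h^\-%E) => //; exact: measurable_funeneg.
Qed.

Lemma le_norm_kernel t : `|\int[mu]_s (K t s * u s)| <= \int[mu]_s `|u s|.
Proof.
apply: (le_trans (le_normr_Rintegral _ (integrable_kernel t))) => //.
apply: le_Rintegral => //.
- by have := integrable_norm (integrable_kernel t).
- exact: (integrable_norm iu).
- by move=> s _; rewrite normrM -[leRHS]mul1r ler_wpM2r.
Qed.

Lemma integrable_kernelM :
  mu.-integrable setT (EFin \o (fun t => p t * \int[mu]_s (K t s * u s))).
Proof.
have bk : [bounded \int[mu]_s (K t s * u s) | t in [set: R]].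
  exists (\int[mu]_s `|u s|); split; first exact: num_real.
  by move=> M uM t _; apply: le_trans (ltW uM); exact: le_norm_kernel.
have := integrableMl measurableT ip measurable_kernel bk.
by [].
Qed.

(** The kernels of interest are cos (t * kap s) and sin (t * kap s); for them this is the real form
    of the adjoint relation [wave_pairing]. *)
Lemma Fubini_kernel :
  \int[mu]_t (p t * \int[mu]_s (K t s * u s)) =
  \int[mu]_s (u s * \int[mu]_t (K t s * p t)).
Proof.
rewrite /Rintegral; congr fine.
transitivity (\int[mu]_t \int[mu]_s f (t, s))%E.
  apply: eq_integral => t _; rewrite EFinM fineK; last exact/integrable_fin_num/integrable_kernel.
  rewrite -integralZl//; last exact: integrable_kernel.
  by apply: eq_integral => s _; rewrite /f /= -EFinM mulrC.
rewrite (Fubini if_); apply: eq_integral => s _.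
have ikp : mu.-integrable setT (EFin \o (fun t => K t s * p t)) by exact: integrable_le1M.
rewrite EFinM fineK; last exact: integrable_fin_num.
rewrite -integralZl//.
by apply: eq_integral => t _; rewrite /f /= -EFinM; congr EFin; ring.
Qed.

End fubini.
End kernel.

(** * Integrals over intervals and substitution *)

Section integrable_EFin.
Context d (T : measurableType d) (R : realType).
Variables (m : {measure set T -> \bar R}) (D : set T).
Hypothesis mD : measurable D.
Implicit Types u v : T -> R.

Lemma integrable_EFinD u v :
  m.-integrable D (EFin \o u) -> m.-integrable D (EFin \o v) ->
  m.-integrable D (EFin \o (fun t => u t + v t)).
Proof. by move=> iu iv; have := integrableD mD iu iv. Qed.

Lemma integrable_EFinB u v :
  m.-integrable D (EFin \o u) -> m.-integrable D (EFin \o v) ->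
  m.-integrable D (EFin \o (fun t => u t - v t)).
Proof. by move=> iu iv; have := integrableB mD iu iv. Qed.

Lemma integrable_EFinZ (c : R) u : m.-integrable D (EFin \o u) ->
  m.-integrable D (EFin \o (fun t => c * u t)).
Proof. by move=> iu; have := integrableZl mD c iu. Qed.

Lemma integrable_EFin_sum N (f : nat -> T -> R) :
  (forall k, m.-integrable D (EFin \o f k)) ->
  m.-integrable D (EFin \o (fun t => \sum_(k < N) f k t)).
Proof.
move=> fi; have := @integrable_sum _ _ _ m _ mD _ (enum 'I_N) predT
  (fun k => EFin \o f k) (fun k _ => fi k).
by apply: eq_integrable => // x _; rewrite /= big_enum/= sumEFin.
Qed.

Lemma Rintegral_sum N (f : nat -> T -> R) :
  (forall k, m.-integrable D (EFin \o f k)) ->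
  \int[m]_(x in D) (\sum_(k < N) f k x) = \sum_(k < N) \int[m]_(x in D) f k x.
Proof.
move=> fi; elim: N => [|N IH].
  under eq_Rintegral do rewrite big_ord0.
  by rewrite big_ord0 Rintegral_cst// mul0r.
under eq_Rintegral do rewrite big_ord_recr/=.
by rewrite big_ord_recr/= -IH RintegralD//; exact: integrable_EFin_sum.
Qed.

Lemma integrable_restrictT u : m.-integrable D (EFin \o u) ->
  m.-integrable setT (EFin \o (u \_ D)).
Proof.
move=> iu; have := (integrable_mkcond (EFin \o u) mD).1 iu.
by apply: eq_integrable => // x _; rewrite /= !patchE; case: ifP.
Qed.

End integrable_EFin.

Section measure_tools.
Context (R : realType).
Notation mu := (@lebesgue_measure R).

Lemma ge0_integral_bigcup_le (F : (set R)^nat) (f : R -> \bar R) (B : \bar R) :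
  nondecreasing_seq F -> (forall i, measurable (F i)) ->
  (forall i, measurable_fun (F i) f) ->
  (forall i x, F i x -> (0 <= f x)%E) ->
  (forall i, (\int[mu]_(x in F i) f x <= B)%E) ->
  (\int[mu]_(x in \bigcup_i F i) f x <= B)%E.
Proof.
move=> nF mF mf f0 fB.
have := ge0_nondecreasing_set_cvg_integral nF mF mf f0 (mu := mu).
move=> /cvg_lim <- //; apply: lime_le; last exact: nearW.
by apply: ereal_nondecreasing_is_cvgn; apply: ge0_nondecreasing_set_nondecreasing_integral.
Qed.

Lemma ge0_integralT_le (f : R -> R) (B : \bar R) : measurable_fun setT f ->
  (forall x, 0 <= f x) ->
  (forall n : nat, (\int[mu]_(x in `[(- n%:R)%R, n%:R%R]) (f x)%:E <= B)%E) ->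
  (\int[mu]_x (f x)%:E <= B)%E.
Proof.
move=> mf f0 fB.
have -> : [set: R] = \bigcup_n `[- n%:R, n%:R]%classic.
  apply/esym/seteqP; split => // x _; exists (Num.bound x) => //=.
  by rewrite in_itv/= -ler_norml ltW// unstable.ltr_norm_bound.
apply: ge0_integral_bigcup_le => //.
- move=> m n mn; apply/subsetPset; apply: subset_itv; rewrite bnd_simp.
    by rewrite lerN2 ler_nat.
  by rewrite ler_nat.
- by move=> i; apply/measurable_EFinP; exact: measurable_funTS.
- by move=> i x _; rewrite lee_fin.
Qed.

(** Continuity of [h'] at each point of the closed interval supplies all the limits needed: around
    an interior point, and on the inner side of an endpoint, [derive1 h] coincides with [h']. *)
Lemma integration_by_substitution_C1 (h h' G : R -> R) (a b : R) : a <= b ->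
  {in `[a, b] &, {homo h : x y / x < y}} ->
  (forall x, x \in `[a, b] -> is_derive x 1 h (h' x)) ->
  (forall x, x \in `[a, b] -> {for x, continuous h'}) ->
  {within `[h a, h b], continuous G} ->
  (\int[mu]_(x in `[h a, h b]) (G x)%:E =
   \int[mu]_(x in `[a, b]) (G (h x) * h' x)%:E)%E.
Proof.
rewrite le_eqVlt => /predU1P[<- *|ab]; first by rewrite !set_itv1 !integral_set1.
move=> hh dh ch' cG.
have hE x : x \in `[a, b] -> derive1 h x = h' x.
  by move=> xab; rewrite derive1E; have := dh _ xab => D; rewrite derive_val.
have hc x : x \in `[a, b] -> {for x, continuous h}.
  move=> xab; apply/differentiable_continuous/derivable1_diffP.
  by have := dh _ xab => -[].
have ain : a \in `[a, b] by rewrite bound_itvE ltW.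
have bin : b \in `[a, b] by rewrite bound_itvE ltW.
rewrite (@integration_by_substitution_increasing _ h G)//.
- by apply: eq_integral => x /[!inE] xab; rewrite /= /GRing.mul/= hE.
- exact: ltW.
- move=> x xab; have xab' : x \in `[a, b] by apply: subset_itv_oo_cc xab.
  rewrite /continuous_at hE//.
  apply: cvg_trans (ch' x xab'); apply: near_eq_cvg.
  near=> z; apply/esym/hE; apply: subset_itv_oo_cc.
  near: z; exact: near_in_itvoo.
- apply: cvgP (h' a) _; apply: cvg_trans (cvg_at_right_filter (ch' a ain)).
  apply: near_eq_cvg; near=> z; apply/esym/hE; rewrite in_itv/=.
  by apply/andP; split; near: z; [exact: nbhs_right_ge|exact: nbhs_right_le].
- apply: cvgP (h' b) _; apply: cvg_trans (cvg_at_left_filter (ch' b bin)).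
  apply: near_eq_cvg; near=> z; apply/esym/hE; rewrite in_itv/=.
  by apply/andP; split; near: z; [exact: nbhs_left_ge|exact: nbhs_left_le].
- split.
  + by move=> x xab; have := dh _ (subset_itv_oo_cc xab) => -[].
  + exact: cvg_at_right_filter (hc _ ain).
  + exact: cvg_at_left_filter (hc _ bin).
Unshelve. all: by end_near. Qed.

Lemma integral_itv_shift (G : R -> R) (a b c : R) : a <= b -> continuous G ->
  (\int[mu]_(x in `[(a + c)%R, (b + c)%R]) (G x)%:E =
   \int[mu]_(x in `[a, b]) (G (x + c))%:E)%E.
Proof.
move=> ab cG.
have -> : (\int[mu]_(x in `[a, b]) (G (x + c))%:E =
   \int[mu]_(x in `[a, b]) (G (x + c) * (fun=> 1) x)%:E)%E.
  by apply: eq_integral => x _; rewrite mulr1.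
apply: (@integration_by_substitution_C1 (fun x => x + c) (fun=> 1) G) => //.
- by move=> x y _ _; rewrite ltrD2r.
- move=> x _; rewrite -[X in is_derive _ _ _ X]addr0; exact: is_deriveD.
- move=> x _; exact: cvg_cst.
- exact: continuous_subspaceT.
Qed.

End measure_tools.

(** * Complex-valued functions and the Fourier transform *)

Section complex_tools.
Context (R : realType).
Notation mu := (@lebesgue_measure R).
Implicit Types (z w : R[i]) (f p : R -> R[i]).

Definition sqmod z : R := complex.Re z ^+ 2 + complex.Im z ^+ 2.

Lemma sqmod_ge0 z : 0 <= sqmod z.
Proof. by rewrite addr_ge0 ?sqr_ge0. Qed.

Lemma cmodulusE z : cmodulus z = Num.sqrt (sqmod z).
Proof. by case: z. Qed.

Lemma cmodulus_sqr z : cmodulus z ^+ 2 = sqmod z.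
Proof. by rewrite cmodulusE sqr_sqrtr// sqmod_ge0. Qed.

Lemma Re_expiM (x : R) z :
  complex.Re (expi x * z) = cos x * complex.Re z - sin x * complex.Im z.
Proof. by case: z. Qed.

Lemma Im_expiM (x : R) z :
  complex.Im (expi x * z) = cos x * complex.Im z + sin x * complex.Re z.
Proof. by case: z. Qed.

Lemma ReD z w : complex.Re (z + w) = complex.Re z + complex.Re w.
Proof. by case: z; case: w. Qed.

Lemma ImD z w : complex.Im (z + w) = complex.Im z + complex.Im w.
Proof. by case: z; case: w. Qed.

Lemma ReB z w : complex.Re (z - w) = complex.Re z - complex.Re w.
Proof. by case: z; case: w. Qed.

Lemma ImB z w : complex.Im (z - w) = complex.Im z - complex.Im w.
Proof. by case: z; case: w. Qed.

Lemma cmeasurableD (D : set R) f p :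
  cmeasurable D f -> cmeasurable D p -> cmeasurable D (fun t => f t + p t).
Proof.
move=> [f1 f2] [p1 p2]; split.
- by under eq_fun do rewrite ReD; exact: measurable_funD.
- by under eq_fun do rewrite ImD; exact: measurable_funD.
Qed.

Lemma cmeasurableB (D : set R) f p :
  cmeasurable D f -> cmeasurable D p -> cmeasurable D (fun t => f t - p t).
Proof.
move=> [f1 f2] [p1 p2]; split.
- by under eq_fun do rewrite ReB; exact: measurable_funB.
- by under eq_fun do rewrite ImB; exact: measurable_funB.
Qed.

Lemma measurable_EFin_sqmod (D : set R) f : cmeasurable D f ->
  measurable_fun D (fun t => (sqmod (f t))%:E).
Proof.
move=> [f1 f2]; apply/measurable_EFinP.
by apply: measurable_funD; exact: measurable_funX.
Qed.

Definition cintegrable (D : set R) f :=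
  mu.-integrable D (EFin \o (fun t => complex.Re (f t))) /\
  mu.-integrable D (EFin \o (fun t => complex.Im (f t))).

Lemma fourier_ReE p tau : complex.Re (fourier p tau) =
  \int[mu]_t (cos (t * tau) * complex.Re (p t) + sin (t * tau) * complex.Im (p t)).
Proof.
by apply: eq_Rintegral => t _; rewrite Re_expiM cosN sinN mulNr opprK.
Qed.

Lemma fourier_ImE p tau : complex.Im (fourier p tau) =
  \int[mu]_t (cos (t * tau) * complex.Im (p t) - sin (t * tau) * complex.Re (p t)).
Proof.
by apply: eq_Rintegral => t _; rewrite Im_expiM cosN sinN mulNr.
Qed.

Lemma norm_cos_le1 (x : R) : `|cos x| <= 1.
Proof. by rewrite ler_norml cos_geN1 cos_le1. Qed.

Lemma norm_sin_le1 (x : R) : `|sin x| <= 1.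
Proof. by rewrite ler_norml sin_geN1 sin_le1. Qed.

Lemma measurable_cosM (D : set R) (c : R) : measurable_fun D (fun t => cos (t * c)).
Proof.
apply: measurable_funTS; apply: measurableT_comp; last exact: mulrr_measurable.
by apply: continuous_measurable_fun; exact: continuous_cos.
Qed.

Lemma measurable_sinM (D : set R) (c : R) : measurable_fun D (fun t => sin (t * c)).
Proof.
apply: measurable_funTS; apply: measurableT_comp; last exact: mulrr_measurable.
by apply: continuous_measurable_fun; exact: continuous_sin.
Qed.

Lemma integrable_cosM (D : set R) (c : R) (u : R -> R) : measurable D ->
  mu.-integrable D (EFin \o u) ->
  mu.-integrable D (EFin \o (fun t => cos (t * c) * u t)).
Proof.
move=> mD iu; apply: (integrable_le1M mD _ _ iu); first exact: measurable_cosM.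
by move=> s; exact: norm_cos_le1.
Qed.

Lemma integrable_sinM (D : set R) (c : R) (u : R -> R) : measurable D ->
  mu.-integrable D (EFin \o u) ->
  mu.-integrable D (EFin \o (fun t => sin (t * c) * u t)).
Proof.
move=> mD iu; apply: (integrable_le1M mD _ _ iu); first exact: measurable_sinM.
by move=> s; exact: norm_sin_le1.
Qed.

Lemma continuous_trig_integral (u v : R -> R) :
  mu.-integrable setT (EFin \o u) -> mu.-integrable setT (EFin \o v) ->
  continuous (fun tau => \int[mu]_t (cos (t * tau) * u t + sin (t * tau) * v t)).
Proof.
move=> iu iv tau.
pose F l t := cos (t * l) * u t + sin (t * l) * v t.
(* The dominating function |u| + |v| does not depend on the parameter, so any interval around [tau]
   would do. *)
have := @continuity_under_integral R _ _ mu F setT measurableT (tau - 1) (tau + 1).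
apply.
- by move=> l _; apply: integrable_EFinD => //; [exact: integrable_cosM|exact: integrable_sinM].
- apply: aeW => t _ l _; rewrite /F.
  apply: cvgD; apply: cvgM; try exact: cvg_cst.
    apply: continuous_comp; last exact: continuous_cos.
    by apply: cvgM => //; exact: cvg_cst.
  apply: continuous_comp; last exact: continuous_sin.
  by apply: cvgM => //; exact: cvg_cst.
- exact: (integrable_EFinD measurableT (integrable_norm iu) (integrable_norm iv)).
- move=> l _; apply: aeW => t _; apply: (le_trans (ler_normD _ _)); rewrite !normrM.
  apply: lerD; rewrite -[leRHS]mul1r ler_wpM2r//.
    exact: norm_cos_le1.
  exact: norm_sin_le1.
- by rewrite inE /= in_itv/= ltrBlDr !ltrDl ltr01.
Qed.

Lemma continuous_fourier_Re p : cintegrable setT p ->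
  continuous (fun tau => complex.Re (fourier p tau)).
Proof.
move=> [ip1 ip2]; have := continuous_trig_integral ip1 ip2.
rewrite (_ : (fun tau => complex.Re (fourier p tau)) = fun tau => \int[mu]_t
  (cos (t * tau) * complex.Re (p t) + sin (t * tau) * complex.Im (p t))) //.
by apply/funext => tau; rewrite fourier_ReE.
Qed.

Lemma continuous_fourier_Im p : cintegrable setT p ->
  continuous (fun tau => complex.Im (fourier p tau)).
Proof.
move=> [ip1 ip2].
have ip1' : mu.-integrable setT (EFin \o (fun t => - complex.Re (p t))).
  by have := integrableN ip1.
have := continuous_trig_integral ip2 ip1'.
rewrite (_ : (fun tau => complex.Im (fourier p tau)) = fun tau => \int[mu]_t
  (cos (t * tau) * complex.Im (p t) + sin (t * tau) * - complex.Re (p t))) //.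
apply/funext => tau; rewrite fourier_ImE.
by apply: eq_Rintegral => t _; rewrite mulrN.
Qed.

Lemma continuous_sqmod_fourier p : cintegrable setT p ->
  continuous (fun tau => sqmod (fourier p tau)).
Proof.
move=> ip tau; rewrite /sqmod; apply: cvgD.
  by rewrite expr2; under eq_fun do rewrite expr2; apply: cvgM; exact: continuous_fourier_Re.
by rewrite expr2; under eq_fun do rewrite expr2; apply: cvgM; exact: continuous_fourier_Im.
Qed.

End complex_tools.

(** * Bessel's inequality for exponentials *)

Section bessel.
Context (R : realType).
Notation mu := (@lebesgue_measure R).

Lemma measurable_EFin_continuous (D : set R) (g : R -> R) : continuous g ->
  measurable_fun D (EFin \o g).
Proof.
move=> cg; apply/measurable_EFinP; apply: measurable_funTS.
exact: continuous_measurable_fun.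
Qed.

Lemma itvcc_lty (a b : R) : (mu `[a, b] < +oo)%E.
Proof. by rewrite lebesgue_measure_itv/=; case: ifPn => // _; rewrite -EFinB ltry. Qed.

Lemma mu_itvcc (a b : R) : a <= b -> mu `[a, b] = (b - a)%:E.
Proof.
rewrite lebesgue_measure_itv/= le_eqVlt => /predU1P[->|ab]; first by rewrite ltxx/= subrr.
by rewrite lte_fin ab.
Qed.

Lemma fine_itvcc (a b : R) : a <= b -> fine (mu `[a, b]) = b - a.
Proof. by move=> ab; rewrite mu_itvcc. Qed.

Lemma integral_itv_cst (a b c : R) : a <= b ->
  (\int[mu]_(x in `[a, b]) c%:E = (c * (b - a))%:E)%E.
Proof. by move=> ab; rewrite integral_cst//= EFinM; congr (_ * _)%E; exact: mu_itvcc. Qed.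

Lemma continuous_integrable_itv (f : R -> R) (a b : R) : continuous f ->
  mu.-integrable `[a, b] (EFin \o f).
Proof.
move=> cf; apply: continuous_compact_integrable; first exact: segment_compact.
exact: continuous_subspaceT.
Qed.

Lemma continuous_cosM (c : R) : continuous (fun t : R => cos (t * c)).
Proof.
move=> t; apply: continuous_comp; last exact: continuous_cos.
by apply: cvgM => //; exact: cvg_cst.
Qed.

Lemma continuous_sinM (c : R) : continuous (fun t : R => sin (t * c)).
Proof.
move=> t; apply: continuous_comp; last exact: continuous_sin.
by apply: cvgM => //; exact: cvg_cst.
Qed.

Lemma continuous_sum N (f : nat -> R -> R) : (forall k, continuous (f k)) ->
  continuous (fun t => \sum_(k < N) f k t).
Proof.
move=> cf; elim: N => [|N IH] t.
  by under eq_fun do rewrite big_ord0; exact: cvg_cst.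
under eq_fun do rewrite big_ord_recr/=.
by apply: cvgD; [exact: IH|exact: cf].
Qed.

(** The antiderivative takes equal values at both ends because the interval contains a whole number
    of periods. That integer is written as a difference of naturals, which will be the indices of
    two frequencies; this is the orthogonality of the exponentials. *)
Lemma integral_trig_periods (a b c al be : R) (j k : nat) : a < b -> c != 0 ->
  (b - a) * c = (pi *+ 2) *+ j - (pi *+ 2) *+ k ->
  \int[mu]_(t in `[a, b]) (al * cos (t * c) + be * sin (t * c)) = 0.
Proof.
move=> ab c0 abc.
pose F t := (al * sin (t * c) - be * cos (t * c)) / c.
have bE : b * c = a * c + (pi *+ 2) *+ j - (pi *+ 2) *+ k.
  by rewrite -addrA -abc; ring.
have sinE : sin (b * c) = sin (a * c).
  by rewrite -(periodicn (@sinD2pi R) k) bE subrK (periodicn (@sinD2pi R)).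
have cosE : cos (b * c) = cos (a * c).
  by rewrite -(periodicn (@cosD2pi R) k) bE subrK (periodicn (@cosD2pi R)).
have dF (x : R) : is_derive x 1 F (al * cos (x * c) + be * sin (x * c)).
  have dm : is_derive x 1 ( *%R^~ c) c.
    have := @is_deriveM _ _ id (cst c) x 1 1 0 (is_derive_id _ _) (is_derive_cst _ _ _).
    by rewrite scaler0 add0r /GRing.scale/= mulr1.
  have ds := @is_derive1_comp _ sin ( *%R^~ c) x _ _ (is_derive_sin (x * c)) dm.
  have dc := @is_derive1_comp _ cos ( *%R^~ c) x _ _ (is_derive_cos (x * c)) dm.
  have -> : al * cos (x * c) + be * sin (x * c) =
    c^-1 *: (al *: (cos (x * c) * c) - be *: (- sin (x * c) * c)).
    by rewrite /GRing.scale/=; field.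
  have -> : F = c^-1 *: (al *: (sin \o *%R^~ c) - be *: (cos \o *%R^~ c)).
    by apply/funext => t; rewrite /F mulrC.
  by apply: is_deriveZ.
rewrite /Rintegral (@continuous_FTC2 _ _ F)//.
- by rewrite /F sinE cosE -EFinB subrr.
- apply: continuous_subspaceT => x; apply: cvgD; apply: cvgM; try exact: cvg_cst.
    exact: continuous_cosM.
  exact: continuous_sinM.
- have cF x : {for x, continuous F}.
    by apply/differentiable_continuous/derivable1_diffP; have := dF x => -[].
  split.
  + by move=> x _; have := dF x => -[].
  + exact: cvg_at_right_filter (cF a).
  + exact: cvg_at_left_filter (cF b).
- by move=> x _; rewrite derive1E; have D := dF x; rewrite derive_val.
Qed.

Section on_interval.
Variables (a b : R) (p : R -> R[i]).
Hypothesis ab : a < b.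
Let L := b - a.
Let I : set R := `[a, b]%classic.
Hypothesis p0 : forall t, ~ I t -> p t = 0.
Hypothesis ip : cintegrable setT p.
Hypothesis ip2 : mu.-integrable setT (EFin \o (fun t => sqmod (p t))).

Let L0 : 0 < L. Proof. by rewrite subr_gt0. Qed.

Let ReI t : ~ I t -> complex.Re (p t) = 0. Proof. by move=> /p0 ->. Qed.
Let ImI t : ~ I t -> complex.Im (p t) = 0. Proof. by move=> /p0 ->. Qed.

Let Rintegral_supp (u : R -> R) : (forall t, ~ I t -> u t = 0) ->
  \int[mu]_t u t = \int[mu]_(t in I) u t.
Proof.
move=> u0; rewrite [RHS]Rintegral_mkcond; apply: eq_Rintegral => t _.
by rewrite patchE; case: ifPn => // /negP tI; rewrite u0// => It; apply: tI; rewrite inE.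
Qed.

Section frequencies.
Variables (theta : R) (N : nat).
Let D := (pi *+ 2) / L.
Let om (k : nat) := theta + k%:R * D.
Let al k := complex.Re (fourier p (om k)).
Let be k := complex.Im (fourier p (om k)).
(** [A k] and [B k] are the real and imaginary parts of F(om k) e^(i t om k), with F the Fourier
    transform of [p]. Their sums [S1] and [S2] form the trigonometric polynomial S against which [p]
    is tested. *)
Let A k t := al k * cos (t * om k) - be k * sin (t * om k).
Let B k t := al k * sin (t * om k) + be k * cos (t * om k).
Let E := \sum_(k < N) sqmod (fourier p (om k)).

Let cA k : continuous (A k).
Proof.
move=> t; apply: cvgB; apply: cvgM; try exact: cvg_cst.
  exact: continuous_cosM.
exact: continuous_sinM.
Qed.

Let cB k : continuous (B k).
Proof.
move=> t; apply: cvgD; apply: cvgM; try exact: cvg_cst.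
  exact: continuous_sinM.
exact: continuous_cosM.
Qed.

Let f k t := complex.Re (p t) * A k t + complex.Im (p t) * B k t.

Let fE k t : f k t =
  al k * (cos (t * om k) * complex.Re (p t) + sin (t * om k) * complex.Im (p t)) +
  be k * (cos (t * om k) * complex.Im (p t) - sin (t * om k) * complex.Re (p t)).
Proof. by rewrite /f /A /B; ring. Qed.

Let if1 k : mu.-integrable setT (EFin \o (fun t =>
  cos (t * om k) * complex.Re (p t) + sin (t * om k) * complex.Im (p t))).
Proof.
by apply: integrable_EFinD => //; [apply: integrable_cosM|apply: integrable_sinM] => //; case: ip.
Qed.

Let if2 k : mu.-integrable setT (EFin \o (fun t =>
  cos (t * om k) * complex.Im (p t) - sin (t * om k) * complex.Re (p t))).
Proof.
by apply: integrable_EFinB => //; [apply: integrable_cosM|apply: integrable_sinM] => //; case: ip.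
Qed.

Let if_ k : mu.-integrable setT (EFin \o f k).
Proof.
have -> : f k = fun t => al k * (cos (t * om k) * complex.Re (p t) + sin (t * om k) * complex.Im (p t)) +
  be k * (cos (t * om k) * complex.Im (p t) - sin (t * om k) * complex.Re (p t)).
  by apply/funext => t; rewrite fE.
by apply: integrable_EFinD => //; apply: integrable_EFinZ.
Qed.

Let int_f k : \int[mu]_t f k t = sqmod (fourier p (om k)).
Proof.
under eq_Rintegral do rewrite fE.
rewrite RintegralD//; last 2 first.
  by apply: integrable_EFinZ.
  by apply: integrable_EFinZ.
by rewrite !RintegralZl// -fourier_ReE -fourier_ImE -!expr2.
Qed.

Let S1 t := \sum_(k < N) A k t.
Let S2 t := \sum_(k < N) B k t.

Let mI : measurable I. Proof. exact: measurable_itv. Qed.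

Let E_pairing : E = \int[mu]_(t in I) (complex.Re (p t) * S1 t + complex.Im (p t) * S2 t).
Proof.
rewrite -Rintegral_supp; last by move=> t It; rewrite ReI// ImI// !mul0r addr0.
rewrite /E; under eq_bigr do rewrite -int_f.
rewrite -Rintegral_sum//; apply: eq_Rintegral => t _.
by rewrite /f big_split/= -!mulr_sumr.
Qed.

Let AB j k t : A j t * A k t + B j t * B k t =
  (al j * al k + be j * be k) * cos (t * (om j - om k)) +
  (al j * be k - be j * al k) * sin (t * (om j - om k)).
Proof. by rewrite (mulrBr t (om j)) cosB sinB /A /B; ring. Qed.

Let iAB j k : mu.-integrable I (EFin \o (fun t => A j t * A k t + B j t * B k t)).
Proof.
apply: continuous_integrable_itv => t.
by apply: cvgD; apply: cvgM; try exact: cA; exact: cB.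
Qed.

Let int_AB j k : \int[mu]_(t in I) (A j t * A k t + B j t * B k t) =
  (j == k)%:R * (L * sqmod (fourier p (om k))).
Proof.
under eq_Rintegral do rewrite AB.
have [->|jk] := eqVneq j k.
  under eq_Rintegral do rewrite subrr mulr0 cos0 sin0 mulr1 mulr0 addr0.
  by rewrite Rintegral_cst// fine_itvcc 1?ltW// mul1r mulrC -!expr2.
rewrite mul0r; have omE : om j - om k = (j%:R - k%:R) * D by rewrite /om; ring.
apply: (@integral_trig_periods _ _ _ _ _ j k) => //.
  rewrite omE mulf_neq0//; first by rewrite subr_eq0 eqr_nat.
  by rewrite mulf_neq0// ?invr_eq0 ?gt_eqF// mulrn_wgt0// pi_gt0.
by rewrite omE -/L /D -!(mulr_natr (pi *+ 2)); field; rewrite gt_eqF.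
Qed.

Let int_S : \int[mu]_(t in I) (S1 t ^+ 2 + S2 t ^+ 2) = L * E.
Proof.
pose g j t := \sum_(k < N) (A j t * A k t + B j t * B k t).
have ig j : mu.-integrable I (EFin \o g j).
  exact: (@integrable_EFin_sum _ _ _ mu I mI N (fun k t => A j t * A k t + B j t * B k t)).
transitivity (\int[mu]_(t in I) \sum_(j < N) g j t).
  apply: eq_Rintegral => t _; rewrite /g !expr2 /S1 /S2 !mulr_suml -big_split/=.
  by apply: eq_bigr => j _; rewrite !mulr_sumr -big_split.
rewrite Rintegral_sum// mulr_sumr; apply: eq_bigr => j _.
rewrite (@Rintegral_sum _ _ _ mu I mI N (fun k t => A j t * A k t + B j t * B k t) (iAB j)) (bigD1 j)//= int_AB eqxx mul1r big1 ?addr0// => k kj.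
by rewrite int_AB eq_sym (negbTE (kj : val k != val j)) mul0r.
Qed.

Let cS1 : continuous S1.
Proof.
move=> t; exact: (continuous_sum (f := A)).
Qed.

Let cS2 : continuous S2.
Proof.
move=> t; exact: (continuous_sum (f := B)).
Qed.

(** The pairing of [p] with S is [E], and orthogonality gives ||S||^2 = L E. Expanding the
    nonnegative integral of |L p - S|^2 / L yields 2 E <= L ||p||^2 + E. *)
Lemma bessel_inequality :
  \sum_(k < N) sqmod (fourier p (theta + k%:R * (pi *+ 2 / (b - a)))) <=
  (b - a) * \int[mu]_t sqmod (p t).
Proof.
rewrite -/L -/D -/E.
have iS : mu.-integrable I (EFin \o (fun t => S1 t ^+ 2 + S2 t ^+ 2)).
  apply: continuous_integrable_itv => t.
  by apply: cvgD; rewrite expr2; under eq_fun do rewrite expr2; apply: cvgM; try exact: cS1; exact: cS2.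
have ipI : mu.-integrable I (EFin \o (fun t => sqmod (p t))).
  exact: integrableS ip2.
have ipS : mu.-integrable I (EFin \o (fun t => complex.Re (p t) * S1 t + complex.Im (p t) * S2 t)).
  rewrite (_ : (fun t => _) = fun t => \sum_(k < N) f k t); last first.
    by apply/funext => t; rewrite /f big_split/= -!mulr_sumr.
  apply: (@integrable_EFin_sum _ _ _ mu I mI N f) => k; exact: integrableS (if_ k).
have H : 2 * E <= L * \int[mu]_t sqmod (p t) + L^-1 * (L * E).
  rewrite -int_S {1}E_pairing (Rintegral_supp (u := fun t => sqmod (p t))); last first.
    by move=> t It; rewrite /sqmod ReI// ImI// expr0n addr0.
  rewrite -!RintegralZl// -RintegralD//; last 2 first.
    by apply: integrable_EFinZ.
    by apply: integrable_EFinZ.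
  apply: le_Rintegral => //.
  - by apply: integrable_EFinZ.
  - by apply: integrable_EFinD => //; apply: integrable_EFinZ.
  move=> t _; rewrite /sqmod.
  set x := complex.Re _; set y := complex.Im _.
  rewrite -subr_ge0.
  have -> : L * (x ^+ 2 + y ^+ 2) + L^-1 * (S1 t ^+ 2 + S2 t ^+ 2) - 2 * (x * S1 t + y * S2 t)
    = L^-1 * ((L * x - S1 t) ^+ 2 + (L * y - S2 t) ^+ 2) by field; rewrite gt_eqF.
  by rewrite mulr_ge0// ?invr_ge0 ?(ltW L0)// addr_ge0 ?sqr_ge0.
move: H; rewrite mulKf ?gt_eqF// => H; lra.
Qed.

End frequencies.

Let G tau := sqmod (fourier p tau).
Let cG : continuous G. Proof. exact: continuous_sqmod_fourier. Qed.
Let D := (pi *+ 2) / L.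
Let D0 : 0 < D. Proof. by rewrite divr_gt0// mulrn_wgt0// pi_gt0. Qed.
Let cGs (c : R) : continuous (fun x => G (x + c)).
Proof.
move=> x; apply: (@continuous_comp _ _ _ (fun x : R => x + c) G); last exact: cG.
by apply: cvgD => //; exact: cvg_cst.
Qed.
Let cGsum N : continuous (fun x => \sum_(k < N) G (x + k%:R * D)).
Proof. exact: (continuous_sum (f := fun k x => G (x + k%:R * D))). Qed.
Let mG (X : set R) : measurable_fun X (EFin \o G).
Proof.
exact: measurable_EFin_continuous.
Qed.

(** Consecutive blocks of length [D], the spacing of the frequencies, are translated back onto the
    first one; the sum that appears is the one in Bessel's inequality. *)
Let integral_blocks theta N : (\int[mu]_(x in `[theta, (theta + N%:R * D)%R]) (G x)%:E =
  \int[mu]_(x in `[theta, (theta + D)%R]) (\sum_(k < N) G (x + k%:R * D))%:E)%E.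
Proof.
elim: N => [|N IH].
  rewrite mul0r addr0 set_itv1 integral_set1.
  by under [RHS]eq_integral do rewrite big_ord0; rewrite integral0.
under [RHS]eq_integral do rewrite big_ord_recr/= EFinD.
rewrite ge0_integralD//=; last 4 first.
- by move=> x _; rewrite lee_fin sumr_ge0// => i _; exact: sqmod_ge0.
- exact: (measurable_EFin_continuous (g := fun x => \sum_(i < N) G (x + i%:R * D))).
- by move=> x _; rewrite lee_fin; exact: sqmod_ge0.
- exact: (measurable_EFin_continuous (g := fun x => G (x + N%:R * D))).
rewrite -IH -integral_itv_shift//; last by rewrite lerDl ltW.
rewrite (@itv_bndbnd_setU _ _ _ (BRight (theta + N%:R * D))); last 2 first.
- by rewrite bnd_simp lerDl mulr_ge0// ltW.
- by rewrite bnd_simp lerD2l ler_pM2r// ler_nat.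
rewrite ge0_integral_setU//=; last 3 first.
- exact: mG.
- by move=> x _; rewrite lee_fin sqmod_ge0.
- apply/disj_setPS => y [/=]; rewrite !in_itv/= => /andP[_ yx] /andP[].
  by rewrite ltNge yx.
congr (_ + _)%E; rewrite integral_itv_obnd_cbnd//.
by have -> : theta + N.+1%:R * D = theta + D + N%:R * D by rewrite -natr1; ring.
Qed.

Lemma fourier_L2_bound :
  (\int[mu]_tau (sqmod (fourier p tau))%:E <=
   (pi *+ 2 * \int[mu]_t sqmod (p t))%:E)%E.
Proof.
have blk theta N : (\int[mu]_(x in `[theta, (theta + N%:R * D)%R]) (G x)%:E <=
    (pi *+ 2 * \int[mu]_t sqmod (p t))%:E)%E.
  rewrite integral_blocks.
  (* Bessel's bound does not depend on [N], and it is integrated over a block of length [D] with D L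
     = 2 pi: this is the constant of the lemma. *)
  apply: (@le_trans _ _ (\int[mu]_(x in `[theta, (theta + D)%R]) (L * \int[mu]_t sqmod (p t))%:E)%E).
    apply: ge0_le_integral => //.
    - by move=> x _; rewrite lee_fin sumr_ge0// => i _; exact: sqmod_ge0.
    - exact: (measurable_EFin_continuous (g := fun x => \sum_(i < N) G (x + i%:R * D))).
    - by move=> x _; rewrite lee_fin; exact: bessel_inequality.
  rewrite integral_itv_cst ?lerDl ?(ltW D0)// lee_fin.
  by rewrite (addrC theta) addrK /D le_eqVlt; apply/orP; left; apply/eqP; field; rewrite gt_eqF.
apply: ge0_integralT_le.
- exact: continuous_measurable_fun.
- by move=> x; exact: sqmod_ge0.
move=> n.
pose N := Num.bound (n%:R *+ 2 / D).
apply: le_trans (blk (- n%:R) N).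
apply: ge0_subset_integral => //.
- exact: mG.
- by move=> x _; rewrite lee_fin sqmod_ge0.
- apply: subset_itvl; rewrite bnd_simp.
  have : n%:R *+ 2 / D < N%:R by exact: unstable.ltr_bound.
  by rewrite ltr_pdivrMr// => H; rewrite addrC -lerBlDr opprK -mulr2n ltW.
Qed.

End on_interval.
End bessel.

(** * Oscillatory integrals and their adjoint *)

Section wave.
Context (R : realType).
Notation mu := (@lebesgue_measure R).
Variables (kap : R -> R) (u p : R -> R[i]).
Hypothesis mkap : measurable_fun setT kap.
Hypothesis iu : cintegrable setT u.
Hypothesis ip : cintegrable setT p.

(** This is the adjoint of the map sending p to its Fourier transform composed with [k]. For [k]
    equal to negation it is the Fourier transform itself, so the bounds for waves apply to that
    too. *)
Definition wave (k : R -> R) (v : R -> R[i]) (t : R) : R[i] :=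
  cintegral setT (fun s => expi (t * k s) * v s).

Let mcos : measurable_fun setT (fun z : R * R => cos (z.1 * kap z.2)).
Proof.
apply: measurableT_comp; first by apply: continuous_measurable_fun; exact: continuous_cos.
by apply: measurable_funM => //; exact: measurableT_comp.
Qed.

Let msin : measurable_fun setT (fun z : R * R => sin (z.1 * kap z.2)).
Proof.
apply: measurableT_comp; first by apply: continuous_measurable_fun; exact: continuous_sin.
by apply: measurable_funM => //; exact: measurableT_comp.
Qed.

Let C (v : R -> R) t := \int[mu]_s (cos (t * kap s) * v s).
Let S (v : R -> R) t := \int[mu]_s (sin (t * kap s) * v s).

Let cosle (t s : R) : `|cos (t * kap s)| <= 1. Proof. exact: norm_cos_le1. Qed.
Let sinle (t s : R) : `|sin (t * kap s)| <= 1. Proof. exact: norm_sin_le1. Qed.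

Let iC v t : mu.-integrable setT (EFin \o v) ->
  mu.-integrable setT (EFin \o (fun s => cos (t * kap s) * v s)).
Proof. by move=> iv; exact: (integrable_kernel mcos cosle iv). Qed.

Let iS v t : mu.-integrable setT (EFin \o v) ->
  mu.-integrable setT (EFin \o (fun s => sin (t * kap s) * v s)).
Proof. by move=> iv; exact: (integrable_kernel msin sinle iv). Qed.

Lemma wave_ReE t : complex.Re (wave kap u t) =
  C (fun s => complex.Re (u s)) t - S (fun s => complex.Im (u s)) t.
Proof.
case: iu => iu1 iu2; rewrite /C /S -RintegralB//; last 2 first.
- exact: iC.
- exact: iS.
by apply: eq_Rintegral => s _; rewrite Re_expiM.
Qed.

Lemma wave_ImE t : complex.Im (wave kap u t) =
  C (fun s => complex.Im (u s)) t + S (fun s => complex.Re (u s)) t.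
Proof.
case: iu => iu1 iu2; rewrite /C /S -RintegralD//; last 2 first.
- exact: iC.
- exact: iS.
by apply: eq_Rintegral => s _; rewrite Im_expiM.
Qed.

Lemma measurable_wave_Re : measurable_fun setT (fun t => complex.Re (wave kap u t)).
Proof.
case: iu => iu1 iu2; under eq_fun do rewrite wave_ReE.
apply: measurable_funB.
- exact: (measurable_kernel mcos cosle iu1).
- exact: (measurable_kernel msin sinle iu2).
Qed.

Lemma measurable_wave_Im : measurable_fun setT (fun t => complex.Im (wave kap u t)).
Proof.
case: iu => iu1 iu2; under eq_fun do rewrite wave_ImE.
apply: measurable_funD.
- exact: (measurable_kernel mcos cosle iu2).
- exact: (measurable_kernel msin sinle iu1).
Qed.

Let ubound := \int[mu]_s `|complex.Re (u s)| + \int[mu]_s `|complex.Im (u s)|.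

Lemma wave_Re_le t : `|complex.Re (wave kap u t)| <= ubound.
Proof.
case: iu => iu1 iu2; rewrite wave_ReE (le_trans (ler_normB _ _))//.
by rewrite lerD//; [exact: (le_norm_kernel mcos cosle iu1)|exact: (le_norm_kernel msin sinle iu2)].
Qed.

Lemma wave_Im_le t : `|complex.Im (wave kap u t)| <= ubound.
Proof.
case: iu => iu1 iu2; rewrite wave_ImE (le_trans (ler_normD _ _))// addrC.
by rewrite lerD//; [exact: (le_norm_kernel msin sinle iu1)|exact: (le_norm_kernel mcos cosle iu2)].
Qed.

(** Splitting into real and imaginary parts leaves four double integrals, two with a cosine and two
    with a sine kernel. Each is exchanged by [Fubini_kernel], and the four results regroup into the
    Fourier transform of [p] at [kap s]. *)
Lemma wave_pairing :
  \int[mu]_t (complex.Re (p t) * complex.Re (wave kap u t) +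
              complex.Im (p t) * complex.Im (wave kap u t)) =
  \int[mu]_s (complex.Re (u s) * complex.Re (fourier p (kap s)) +
              complex.Im (u s) * complex.Im (fourier p (kap s))).
Proof.
case: iu => iu1 iu2; case: ip => ip1 ip2.
set u1 := fun s => complex.Re (u s); set u2 := fun s => complex.Im (u s).
set p1 := fun s => complex.Re (p s); set p2 := fun s => complex.Im (p s).
have iMC q v : mu.-integrable setT (EFin \o q) -> mu.-integrable setT (EFin \o v) ->
    mu.-integrable setT (EFin \o (fun t => q t * C v t)).
  by move=> iq iv; exact: (integrable_kernelM mcos cosle iv iq).
have iMS q v : mu.-integrable setT (EFin \o q) -> mu.-integrable setT (EFin \o v) ->
    mu.-integrable setT (EFin \o (fun t => q t * S v t)).
  by move=> iq iv; exact: (integrable_kernelM msin sinle iv iq).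
have mcos' : measurable_fun setT (fun z : R * R => cos (z.2 * kap z.1)).
  apply: measurableT_comp; first by apply: continuous_measurable_fun; exact: continuous_cos.
  by apply: measurable_funM => //; exact: measurableT_comp.
have msin' : measurable_fun setT (fun z : R * R => sin (z.2 * kap z.1)).
  apply: measurableT_comp; first by apply: continuous_measurable_fun; exact: continuous_sin.
  by apply: measurable_funM => //; exact: measurableT_comp.
pose C' (q : R -> R) s := \int[mu]_t (cos (t * kap s) * q t).
pose S' (q : R -> R) s := \int[mu]_t (sin (t * kap s) * q t).
have iMC' q v : mu.-integrable setT (EFin \o q) -> mu.-integrable setT (EFin \o v) ->
    mu.-integrable setT (EFin \o (fun t => q t * C' v t)).
  move=> iq iv.
  exact: (integrable_kernelM (K := fun s t => cos (t * kap s)) mcos' (fun s t => cosle t s) iv iq).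
have iMS' q v : mu.-integrable setT (EFin \o q) -> mu.-integrable setT (EFin \o v) ->
    mu.-integrable setT (EFin \o (fun t => q t * S' v t)).
  move=> iq iv.
  exact: (integrable_kernelM (K := fun s t => sin (t * kap s)) msin' (fun s t => sinle t s) iv iq).
have FC q v : mu.-integrable setT (EFin \o q) -> mu.-integrable setT (EFin \o v) ->
    \int[mu]_t (q t * C v t) = \int[mu]_s (v s * C' q s).
  by move=> iq iv; exact: (Fubini_kernel mcos cosle iv iq).
have FS q v : mu.-integrable setT (EFin \o q) -> mu.-integrable setT (EFin \o v) ->
    \int[mu]_t (q t * S v t) = \int[mu]_s (v s * S' q s).
  by move=> iq iv; exact: (Fubini_kernel msin sinle iv iq).
transitivity (\int[mu]_t ((p1 t * C u1 t - p1 t * S u2 t) + (p2 t * C u2 t + p2 t * S u1 t))).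
  by apply: eq_Rintegral => t _; rewrite wave_ReE wave_ImE mulrBr mulrDr.
have icos q s : mu.-integrable setT (EFin \o q) ->
    mu.-integrable setT (EFin \o (fun t => cos (t * kap s) * q t)).
  exact: integrable_cosM.
have isin q s : mu.-integrable setT (EFin \o q) ->
    mu.-integrable setT (EFin \o (fun t => sin (t * kap s) * q t)).
  exact: integrable_sinM.
transitivity (\int[mu]_s ((u1 s * C' p1 s + u1 s * S' p2 s) + (u2 s * C' p2 s - u2 s * S' p1 s))).
  have i1 := iMC _ _ ip1 iu1; have i2 := iMS _ _ ip1 iu2.
  have i3 := iMC _ _ ip2 iu2; have i4 := iMS _ _ ip2 iu1.
  have j1 := iMC' _ _ iu1 ip1; have j2 := iMS' _ _ iu1 ip2.
  have j3 := iMC' _ _ iu2 ip2; have j4 := iMS' _ _ iu2 ip1.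
  rewrite (RintegralD measurableT (integrable_EFinB measurableT i1 i2) (integrable_EFinD measurableT i3 i4)).
  rewrite (RintegralB measurableT i1 i2) (RintegralD measurableT i3 i4).
  rewrite (RintegralD measurableT (integrable_EFinD measurableT j1 j2) (integrable_EFinB measurableT j3 j4)).
  rewrite (RintegralD measurableT j1 j2) (RintegralB measurableT j3 j4).
  rewrite (FC _ _ ip1 iu1) (FS _ _ ip1 iu2) (FC _ _ ip2 iu2) (FS _ _ ip2 iu1).
  have rearr (x y z t : R) : x - y + (z + t) = x + t + (z - y) by ring.
  exact: rearr.
apply: eq_Rintegral => s _; rewrite fourier_ReE fourier_ImE.
rewrite (RintegralD measurableT (icos _ s ip1) (isin _ s ip2)).
by rewrite (RintegralB measurableT (icos _ s ip2) (isin _ s ip1)) mulrBr mulrDr.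
Qed.

End wave.

(** * Completeness of L2 *)

Section riesz_fischer.
Context d (T : measurableType d) (R : realType).
Variables (m : {measure set T -> \bar R}) (D : set T).
Hypothesis mD : measurable D.

Lemma limn_einf_le (u : (\bar R)^nat) (B : \bar R) :
  (forall n, (u n <= B)%E) -> (limn_einf u <= B)%E.
Proof.
move=> uB; rewrite limn_einf_lim; apply: lime_le; first exact: is_cvg_einfs.
by apply: nearW => n; apply: le_trans (uB n); apply: ereal_inf_lbound; exists n => /=.
Qed.

Lemma geometric_half_sum_le2 n : \sum_(0 <= k < n) (2^-1 : R) ^+ k <= 2.
Proof.
have geoE : series (geometric 1 (2^-1 : R)) n = 1 * (1 - 2^-1 ^+ n) / (1 - 2^-1).
  by rewrite geometric_seriesE// lt_eqF// invf_lt1// ltr1n.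
have -> : \sum_(0 <= k < n) (2^-1 : R) ^+ k = (1 - 2^-1 ^+ n) / (1 - 2^-1).
  by rewrite -[X in X / _]mul1r -geoE; apply: eq_bigr => k _; rewrite /geometric/= mul1r.
have : 0 <= (2^-1 : R) ^+ n by rewrite exprn_ge0.
by move=> hn; rewrite ler_pdivrMr; lra.
Qed.

(* Weighting the increments by [2 ^ n] makes them absolutely summable by AM-GM. *)
Lemma cvgn_weighted_increments (W : R^nat) (M : R) :
  (forall n, \sum_(0 <= k < n) (2 ^+ k * (W k.+1 - W k) ^+ 2) <= M) -> cvgn W.
Proof.
move=> WM.
have -> : W = (fun n => W 0%N + series (telescope W) n).
  by apply/funext => n; rewrite -eq_sum_telescope.
apply: is_cvgD; first exact: is_cvg_cst.
apply: normed_cvg.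
have -> : [normed series (telescope W)] = series (fun k => `|telescope W k|) by [].
apply: nondecreasing_is_cvgn.
  apply/nondecreasing_seqP => n; rewrite seriesSr lerDl.
  exact: normr_ge0.
exists ((2 + M) / 2) => _ [n _ <-]; rewrite /series/=.
apply: (@le_trans _ _ ((\sum_(0 <= k < n) (2^-1) ^+ k +
    \sum_(0 <= k < n) (2 ^+ k * (W k.+1 - W k) ^+ 2)) / 2)); last first.
  by rewrite ler_pM2r// lerD// geometric_half_sum_le2.
rewrite -big_split/= mulr_suml; apply: ler_sum => k _.
rewrite /telescope/= exprVn; set x := _ - _; set q : R := 2 ^+ k.
have q0 : 0 < q by rewrite exprn_gt0.
rewrite ler_pdivlMr// -subr_ge0.
have -> : q^-1 + q * x ^+ 2 - `|x| * 2 = q^-1 * (1 - q * `|x|) ^+ 2.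
  rewrite -(real_normK (num_real x)); field; exact: lt0r_neq0.
by rewrite mulr_ge0 ?sqr_ge0// invr_ge0 ltW.
Qed.

(** Against the rate 4^-n the weights 2^n leave 2^-n, so the weighted series [g] of squared
    increments is integrable, hence finite almost everywhere, and [cvgn_weighted_increments] applies
    at each such point. *)
Lemma L2_cauchy_seq_limit (W : nat -> T -> R) :
  (forall n, measurable_fun D (W n)) ->
  (forall n, (\int[m]_(t in D) ((W n.+1 t - W n t) ^+ 2)%:E <= (4^-1 ^+ n)%:E)%E) ->
  exists v : T -> R, measurable_fun D v /\
    {ae m, forall t, D t -> W n t @[n --> \oo] --> v t}.
Proof.
move=> mW dW.
pose h k t : \bar R := (2 ^+ k * (W k.+1 t - W k t) ^+ 2)%:E.
have h0 k t : (0 <= h k t)%E by rewrite lee_fin mulr_ge0 ?sqr_ge0// exprn_ge0.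
have mdW k : measurable_fun D (fun t => ((W k.+1 t - W k t) ^+ 2)%:E).
  by apply/measurable_EFinP; apply: measurable_funX; exact: measurable_funB.
have mh k : measurable_fun D (h k).
  apply/measurable_EFinP; apply: measurable_funM => //.
  by apply: measurable_funX; exact: measurable_funB.
pose g t := (\sum_(0 <= k <oo) h k t)%E.
have g0 t : (0 <= g t)%E by apply: nneseries_ge0.
have mg : measurable_fun D g by apply: ge0_emeasurable_sum => // k t _ _; exact: h0.
have ig : m.-integrable D g.
  apply/integrableP; split => //.
  under eq_integral do rewrite gee0_abs//.
  rewrite integral_nneseries//.
  apply: (@le_lt_trans _ _ 2%:E); last exact: ltry.
  apply: lime_le; first by apply: is_cvg_nneseries => k _ _; apply: integral_ge0.
  apply: nearW => n.
  apply: (@le_trans _ _ (\sum_(0 <= k < n) ((2^-1) ^+ k)%:E)%E).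
    apply: lee_sum => k _.
    under eq_integral do rewrite /h EFinM.
    rewrite ge0_integralZl//; last by move=> t _; rewrite lee_fin sqr_ge0.
    apply: (le_trans (lee_wpmul2l _ (dW k))); first by rewrite lee_fin exprn_ge0.
    rewrite -EFinM -exprMn lee_fin; have -> : 2 * 4^-1 = 2^-1 :> R by field.
    by [].
  by rewrite sumEFin lee_fin geometric_half_sum_le2.
(* The limit superior is measurable whether or not the sequence converges, and equals the limit
   wherever [g] is finite. *)
exists (fun t => fine (limn_esup (fun n => (W n t)%:E))); split.
  apply: measurableT_comp => //.
  by apply: measurable_fun_limn_esup => n; apply/measurable_EFinP.
have := integrable_ae mD ig; apply: filterS => t gt Dt.
have cW : cvgn (W ^~ t).
  apply: (@cvgn_weighted_increments _ (fine (g t))) => n.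
  rewrite -lee_fin fineK; last exact: gt.
  rewrite -sumEFin; apply: (@nneseries_lim_ge _ (fun k => h k t)) => k _ _; exact: h0.
have /cvg_limn_einf_sup[_ ->] : (W n t)%:E @[n --> \oo] --> (limn (W ^~ t))%:E.
  by apply: cvg_EFin; [exact: nearW|].
by [].
Qed.

(** The limit is built along a sequence of radii, but the estimate is recovered for every [r]:
    Fatou's lemma, applied to the squared distance from [w r] to later members of the sequence,
    passes the bound [tau r] to the limit. *)
Lemma L2_cauchy_limit (w : R -> T -> R) (r0 : R) (tau : R -> R) :
  (forall r, measurable_fun D (w r)) ->
  (forall r r', r0 <= r -> r <= r' ->
     (\int[m]_(t in D) ((w r' t - w r t) ^+ 2)%:E <= (tau r)%:E)%E) ->
  tau r @[r --> +oo] --> 0 ->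
  exists v : T -> R, measurable_fun D v /\
    forall r, r0 <= r -> (\int[m]_(t in D) ((w r t - v t) ^+ 2)%:E <= (tau r)%:E)%E.
Proof.
move=> mw cw tau0.
(* The last condition gives the rate required by [L2_cauchy_seq_limit]; [k%:R <= rho] makes the
   radii pass every given [r]. *)
have /choice[rho rhoP] (k : nat) : exists rho : R,
    [/\ r0 <= rho, k%:R <= rho & forall r, rho <= r -> tau r <= 4^-1 ^+ k].
  have e0 : 0 < (4^-1 : R) ^+ k by rewrite exprn_gt0.
  move/cvgrPdist_le : tau0 => /(_ _ e0)[A [Areal HA]].
  exists (Num.max (Num.max r0 k%:R) (A + 1)); split.
  - by rewrite !le_max lexx.
  - by rewrite !le_max lexx orbT.
  move=> r; rewrite ge_max => /andP[_ Ar].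
  have /HA : A < r by rewrite (lt_le_trans _ Ar)// ltrDl.
  by rewrite sub0r normrN; apply: le_trans; exact: ler_norm.
(* A running maximum keeps the radii nondecreasing, so that [cw] applies to consecutive ones. *)
pose rr := fix rr k := if k is k'.+1 then Num.max (rr k') (rho k) else rho 0%N.
have rr_ge k : rho k <= rr k by case: k => //= k; rewrite le_max lexx orbT.
have rr_nd k : rr k <= rr k.+1 by rewrite /= le_max lexx.
have rr_mono k l : (k <= l)%N -> rr k <= rr l.
  by move/(nondecreasing_seqP rr).1 : rr_nd; exact.
have r0rr k : r0 <= rr k by apply: le_trans (rr_ge k); have [] := rhoP k.
have nrr k : k%:R <= rr k by apply: le_trans (rr_ge k); have [] := rhoP k.
have [|v [mv vP]] := @L2_cauchy_seq_limit (fun k => w (rr k)) (fun k => mw _).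
  move=> k; apply: (le_trans (cw _ _ (r0rr k) (rr_nd k))).
  by rewrite lee_fin; have [_ _] := rhoP k; apply; exact: rr_ge.
exists v; split => // r r0r.
pose K := Num.bound r.
have rrK k : r <= rr (k + K)%N.
  apply: le_trans (rr_mono _ _ (leq_addl k K)); apply: le_trans (nrr K).
  by rewrite ltW// unstable.ltr_bound.
pose f k t : \bar R := ((w (rr (k + K)%N) t - w r t) ^+ 2)%:E.
have mf k : measurable_fun D (f k).
  by apply/measurable_EFinP; apply: measurable_funX; exact: measurable_funB.
apply: (@le_trans _ _ (\int[m]_(t in D) limn_einf (f ^~ t))%E); last first.
  apply: (le_trans (fatou m mD mf _)); first by move=> n t _; rewrite lee_fin sqr_ge0.
  by apply: limn_einf_le => n; exact: cw.
apply: ae_ge0_le_integral => //.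
- by move=> t _; rewrite lee_fin sqr_ge0.
- by apply/measurable_EFinP; apply: measurable_funX; exact: measurable_funB.
- move=> t _; rewrite limn_einf_lim; apply: lime_ge; first exact: is_cvg_einfs.
  apply: nearW => n; apply: le_ereal_inf_tmp => _ [k /= nk <-].
  by rewrite lee_fin sqr_ge0.
- have -> : (fun t => limn_einf (f ^~ t)) = (fun t => - limn_esup (fun k => - f k t))%E.
    by apply/funext => t; rewrite (limn_esupN (f ^~ t)) oppeK.
  apply: measurableT_comp => //; apply: measurable_fun_limn_esup => k.
  exact: measurableT_comp.
apply: filterS vP => t vt Dt.
have /cvg_limn_einf_sup[-> _] : f k t @[k --> \oo] --> ((w r t - v t) ^+ 2)%:E.
  apply: cvg_EFin; first exact: nearW.
  rewrite -[(_ - v t) ^+ 2]sqrrN opprB.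
  have c : w (rr (k + K)%N) t - w r t @[k --> \oo] --> v t - w r t.
    apply: cvgB; last exact: cvg_cst.
    by have := vt Dt; rewrite -(cvg_shiftn K).
  by rewrite expr2; exact: (cvgM c c).
by [].
Qed.

End riesz_fischer.

(** * The phase *)

Section phase.
Context (R : realType).
Notation mu := (@lebesgue_measure R).

Definition phase (a b s : R) : R := b * s + s `^ a.

Lemma mulr_powRB1_gt0 (a s : R) : 0 < s -> s * s `^ (a - 1) = s `^ a.
Proof.
move=> s0; rewrite -{1}(powRr1 (ltW s0)) -powRD; first by rewrite addrCA subrr addr0.
by rewrite (gt_eqF s0) implybT.
Qed.

Lemma continuous_powR_gt0 (p s : R) : 0 < s -> {for s, continuous (fun x : R => x `^ p)}.
Proof.
move=> s0; apply/differentiable_continuous/derivable1_diffP.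
by have := is_derive1_powR p s0 => -[].
Qed.

Lemma measurable_phase (a b : R) (D : set R) : measurable_fun D (phase a b).
Proof.
apply: measurable_funTS; apply: measurable_funD; last exact: measurable_powR.
exact: mulrl_measurable.
Qed.

Lemma is_derive_phase (a b s : R) : 0 < s ->
  is_derive s 1 (phase a b) (b + a * s `^ (a - 1)).
Proof.
move=> s0; have dp := is_derive1_powR a s0.
have dm : is_derive s 1 ( *%R b) b.
  have := @is_deriveZ _ _ _ id b s 1 1 (is_derive_id _ _).
  by rewrite /GRing.scale/= mulr1.
exact: (@is_deriveD _ _ _ ( *%R b) (fun x => x `^ a) s 1 _ _ dm dp).
Qed.

Lemma gt0_powR_monotone (p x y : R) : 0 < x -> x <= y ->
  if 0 <= p then x `^ p <= y `^ p else y `^ p <= x `^ p.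
Proof.
move=> x0 xy; have y0 := lt_le_trans x0 xy.
case: ifPn => p0; first by apply: ge0_ler_powR => //; rewrite nnegrE ltW.
rewrite -ltNge in p0; rewrite -(opprK p) !(powRN _ (- p)) lef_pV2 ?posrE ?powR_gt0//.
by apply: ge0_ler_powR => //; rewrite ?nnegrE ?ltW// oppr_gt0.
Qed.

(** One of the two terms of the derivative dominates at infinity. For a > 1 it is a s^(a-1), once
    this is at least 2 |b|, and [e] is 1. For a < 1 it is [b], once a s^(a-1) is at most |b| / 2,
    and [e] is the sign of [b]; here b != 0 is essential. *)
Lemma phase_tail (a b : R) : 0 < a -> a != 1 -> b != 0 ->
  exists r0 e : R, [/\ 0 < r0, e ^+ 2 = 1 &
    forall s, r0 <= s -> s `^ (a - 1) <= 2 / a * (e * (b + a * s `^ (a - 1)))].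
Proof.
move=> a0 a1 b0.
have am1 : a - 1 != 0 by rewrite subr_eq0.
have nb0 : 0 < `|b| by rewrite normr_gt0.
have rootE (x : R) : 0 < x -> (x `^ (a - 1)^-1) `^ (a - 1) = x.
  by move=> x0; rewrite -powRrM mulVf// powRr1// ltW.
have [a_gt1|a_le1] := ltP 1 a.
  pose x := 2 * `|b| / a.
  have x0 : 0 < x by rewrite divr_gt0// mulr_gt0.
  exists (x `^ (a - 1)^-1), 1; split; [exact: powR_gt0|by rewrite expr1n|].
  move=> s xs; rewrite mul1r.
  have := @gt0_powR_monotone (a - 1) _ _ (powR_gt0 _ x0) xs.
  rewrite subr_ge0 (ltW a_gt1) rootE// /x ler_pdivrMr// => H.
  have := ler_norm (- b); rewrite normrN => Hb.
  rewrite mulrAC ler_pdivlMr//; lra.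
have a_lt1 : a < 1 by rewrite lt_neqAle a1.
pose x := `|b| / (2 * a).
have x0 : 0 < x by rewrite divr_gt0// mulr_gt0.
exists (x `^ (a - 1)^-1), (Num.sg b); split; [exact: powR_gt0|by rewrite sqr_sg b0|].
move=> s xs.
have := @gt0_powR_monotone (a - 1) _ _ (powR_gt0 _ x0) xs.
rewrite subr_ge0 leNgt a_lt1/= rootE// /x ler_pdivlMr ?mulr_gt0// => H.
have sgle : Num.sg b * (a * s `^ (a - 1)) >= - (a * s `^ (a - 1)).
  have : `|Num.sg b * (a * s `^ (a - 1))| <= a * s `^ (a - 1).
    by rewrite normrM normr_sg b0 mul1r ger0_norm// mulr_ge0 ?powR_ge0// ltW.
  by rewrite ler_norml => /andP[].
rewrite mulrDr -normrEsg mulrAC ler_pdivlMr//; lra.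
Qed.

Lemma integral_itv_opp_le (G : R -> R) (B : \bar R) : continuous G ->
  (forall x, 0 <= G x) -> (\int[mu]_x (G x)%:E <= B)%E ->
  (\int[mu]_x (G (- x))%:E <= B)%E.
Proof.
move=> cG G0 GB.
have cGN : continuous (fun x => G (- x)).
  move=> x; apply: (@continuous_comp _ _ _ (fun x : R => - x) G); last exact: cG.
  exact: opp_continuous.
apply: ge0_integralT_le => //; first exact: continuous_measurable_fun.
move=> n; rewrite -[X in (_ <= X)%E]/B; apply: le_trans GB.
have := @integration_by_substitution_oppr R G (- n%:R) n%:R.
rewrite opprK => H; rewrite -[X in (X <= _)%E]H//; last 2 first.
- by rewrite (@le_trans _ _ 0)// oppr_le0.
- exact: continuous_subspaceT.
apply: ge0_subset_integral => //.
- exact: measurable_EFin_continuous.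
- by move=> x _; rewrite lee_fin.
Qed.

(** The function e times the phase is increasing on the interval and serves as the new variable. The
    image is some interval, and positivity of [G] lets it be enlarged to the whole line; the sign
    [e] is absorbed by reflection. *)
Lemma integral_phase_le (a b e r r' : R) (G : R -> R) (B : \bar R) :
  continuous G -> (forall x, 0 <= G x) -> (\int[mu]_x (G x)%:E <= B)%E ->
  e ^+ 2 = 1 -> 0 < r -> r <= r' ->
  (forall s, r <= s -> 0 < e * (b + a * s `^ (a - 1))) ->
  (\int[mu]_(s in `[r, r'])
     (G (phase a b s) * (e * (b + a * s `^ (a - 1))))%:E <= B)%E.
Proof.
move=> cG G0 GB e1 r0 rr' dpos.
pose h s := e * phase a b s.
pose h' s := e * (b + a * s `^ (a - 1)).
have dh (s : R) : 0 < s -> is_derive s 1 h (h' s).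
  move=> s0; have D := is_derive_phase a b s0.
  exact: (@is_deriveZ _ _ _ (phase a b) e s 1 _ D).
have gts s : s \in `[r, r'] -> 0 < s.
  by rewrite in_itv/= => /andP[rs _]; exact: lt_le_trans rs.
have hcont (s : R) : 0 < s -> {for s, continuous h}.
  move=> s0; apply/differentiable_continuous/derivable1_diffP.
  by have := dh _ s0 => -[].
have hincr : {in `[r, r'] &, {homo h : x y / x < y}}.
  move=> x y; rewrite !in_itv/= => /andP[rx _] /andP[_ yr'] xy.
  apply: (@gtr0_derive1_incr _ h r r') => //.
  - move=> z zrr; have := dh _ (gts _ (subset_itv_oo_cc zrr)) => -[]; by [].
  - move=> z zrr; rewrite derive1E; have D := dh _ (gts _ (subset_itv_oo_cc zrr)).
    rewrite derive_val; apply: dpos.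
    by move: zrr; rewrite in_itv/= => /andP[/ltW].
  - apply: continuous_in_subspaceT => z /[!inE] zrr; apply: hcont; exact: gts.
have cGe : continuous (fun x => G (e * x)).
  move=> x; apply: (@continuous_comp _ _ _ (fun x : R => e * x) G); last exact: cG.
  by apply: cvgM => //; exact: cvg_cst.
have GeB : (\int[mu]_x (G (e * x))%:E <= B)%E.
  move/eqP : e1; rewrite sqrf_eq1 => /orP[] /eqP ->.
    by under eq_integral do rewrite mul1r.
  by under eq_integral do rewrite mulN1r; exact: integral_itv_opp_le.
have -> : (\int[mu]_(s in `[r, r']) (G (phase a b s) * (e * (b + a * s `^ (a - 1))))%:E =
  \int[mu]_(s in `[r, r']) ((fun x => G (e * x)) (h s) * h' s)%:E)%E.
  by apply: eq_integral => s _; rewrite /h (mulrA e e) -expr2 e1 mul1r.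
rewrite -(@integration_by_substitution_C1 _ h h' (fun x => G (e * x)) r r' rr' hincr
  (fun s sr => dh s (gts s sr)))//; last 2 first.
- move=> s /gts s0; apply: cvgM; first exact: cvg_cst.
  apply: cvgD; first exact: cvg_cst.
  by apply: cvgM; [exact: cvg_cst|exact: continuous_powR_gt0].
- exact: continuous_subspaceT.
apply: le_trans GeB; apply: ge0_subset_integral => //.
- exact: measurable_EFin_continuous.
- by move=> x _; rewrite lee_fin.
Qed.

(** It serves integrands such as x^(a-1) or x^(-1/2), which may be discontinuous at 0: substitution
    is carried out on [d, c] only, with a bound uniform in [d]. *)
Lemma ge0_integral_itv0c_le (f : R -> R) (c : R) (B : \bar R) : 0 <= c ->
  measurable_fun setT f -> (forall x, 0 <= f x) ->
  (forall d, 0 < d -> d <= c -> (\int[mu]_(x in `[d, c]) (f x)%:E <= B)%E) ->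
  (0 <= B)%E -> (\int[mu]_(x in `[0%R, c]) (f x)%:E <= B)%E.
Proof.
move=> c0 mf f0 fB B0; have [c_eq0|c_neq0] := eqVneq c 0.
  by rewrite c_eq0 set_itv1 integral_set1.
have c_gt0 : 0 < c by rewrite lt_neqAle eq_sym c_neq0.
rewrite -integral_itv_obnd_cbnd; last first.
  by apply: measurable_funTS; exact/measurable_EFinP.
have -> : `]0, c]%classic = \bigcup_n `[c / n.+1%:R, c]%classic.
  apply/seteqP; split => [x /=|x [n _] /=]; last first.
    rewrite !in_itv/= => /andP[cx ->]; rewrite andbT.
    by apply: lt_le_trans cx; rewrite divr_gt0.
  rewrite in_itv/= => /andP[x0 xc]; exists (Num.bound (c / x)) => //=.
  rewrite in_itv/= xc andbT ler_pdivrMr// mulrC -ler_pdivrMr//.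
  apply: (@le_trans _ _ (Num.bound (c / x))%:R); last by rewrite ler_nat.
  by rewrite ltW// unstable.ltr_bound.
apply: ge0_integral_bigcup_le => //.
- move=> k l kl; apply/subsetPset/subset_itvr; rewrite bnd_simp.
  by rewrite ler_pM2l// lef_pV2 ?posrE// ler_nat.
- by move=> i; apply: measurable_funTS; exact/measurable_EFinP.
- by move=> i x _; rewrite lee_fin.
- by move=> i; apply: fB; rewrite ?divr_gt0// ler_pdivrMr// ler_peMr// ler1n.
Qed.

(** Up to the factor [a] the integrand is the derivative of x^a, so the integral over [d, r] is (r^a
    - d^a) / a, at most r^a / a. *)
Lemma integrable_powRB1 (a r : R) : 0 < a -> 0 <= r ->
  mu.-integrable `[0, r] (EFin \o (fun s => s `^ (a - 1))).
Proof.
move=> a0 r0; apply/integrableP; split.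
  by apply/measurable_EFinP; apply: measurable_funTS; exact: measurable_powR.
under eq_integral do rewrite /= ger0_norm ?powR_ge0//.
apply: (@le_lt_trans _ _ (r `^ a / a)%:E); last exact: ltry.
apply: ge0_integral_itv0c_le => //.
- by move=> x; exact: powR_ge0.
- move=> d d0 dr.
  rewrite -(@lee_pmul2l _ a%:E)// -ge0_integralZl ?lee_fin ?(ltW a0)//; last 2 first.
  + by apply/measurable_EFinP; apply: measurable_funTS; exact: measurable_powR.
  + by move=> x _; rewrite lee_fin powR_ge0.
  have gts s : s \in `[d, r] -> 0 < s.
    by rewrite in_itv/= => /andP[rs _]; exact: lt_le_trans rs.
  have -> : (\int[mu]_(x in `[d, r]) (a%:E * (x `^ (a - 1))%:E) =
     \int[mu]_(x in `[d, r]) ((fun=> 1) (x `^ a) * (a * x `^ (a - 1)))%:E)%E.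
    by apply: eq_integral => x _; rewrite mul1r.
  have incr : {in `[d, r] &, {homo (fun x : R => x `^ a) : x y / x < y}}.
    by move=> x y /gts x0 /gts y0 xy; apply: gt0_ltr_powR => //; rewrite nnegrE ltW.
  rewrite -(@integration_by_substitution_C1 _ (fun x : R => x `^ a)
    (fun x => a * x `^ (a - 1)) (fun=> 1) d r dr incr
    (fun x xr => is_derive1_powR a (gts x xr)))//; last 2 first.
  + move=> x /gts x0; apply: cvgM; [exact: cvg_cst|exact: continuous_powR_gt0].
  + by apply: continuous_subspaceT => x; exact: cvg_cst.
  rewrite integral_itv_cst; last first.
    by apply: ge0_ler_powR; rewrite ?nnegrE// ltW.
  rewrite -EFinM lee_fin mul1r mulrC divfK ?gt_eqF//.
  by rewrite lerBlDr lerDl powR_ge0.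
- by rewrite lee_fin divr_ge0 ?powR_ge0// ltW.
Qed.

End phase.

(** * The solution carried by a half-line of frequencies *)

Section restriction.
Context (R : realType).
Notation mu := (@lebesgue_measure R).
Implicit Types (f v : R -> R[i]) (D : set R).

Definition crestrict D f (t : R) : R[i] := if t \in D then f t else 0.

Lemma Re_restrict f D : (fun t => complex.Re (crestrict D f t)) = (fun t => complex.Re (f t)) \_ D.
Proof. by apply/funext => t; rewrite /crestrict patchE; case: ifP. Qed.

Lemma Im_restrict f D : (fun t => complex.Im (crestrict D f t)) = (fun t => complex.Im (f t)) \_ D.
Proof. by apply/funext => t; rewrite /crestrict patchE; case: ifP. Qed.

Lemma sqmod_restrict f D : (fun t => sqmod (crestrict D f t)) = (fun t => sqmod (f t)) \_ D.
Proof.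
by apply/funext => t; rewrite /crestrict patchE; case: ifP => // _; rewrite /sqmod/= expr0n addr0.
Qed.

Lemma cintegrable_restrictT f D : measurable D -> cintegrable D f ->
  cintegrable setT (crestrict D f).
Proof.
by move=> mD [i1 i2]; split; rewrite ?Re_restrict ?Im_restrict; exact: integrable_restrictT.
Qed.

Lemma cintegrableS (D E : set R) f : measurable D -> measurable E -> E `<=` D ->
  cintegrable D f -> cintegrable E f.
Proof. by move=> mD mE ED [i1 i2]; split; [exact: integrableS i1|exact: integrableS i2]. Qed.

Lemma wave_restrict (k : R -> R) v D t :
  wave k (crestrict D v) t = cintegral D (fun s => expi (t * k s) * v s).
Proof.
rewrite /wave /cintegral; congr Complex; rewrite [RHS]Rintegral_mkcond;
  by apply: eq_Rintegral => s _; rewrite /crestrict patchE; case: ifP => // _; rewrite mulr0.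
Qed.

Lemma cintegrable_expiM (k : R -> R) f D (t : R) : measurable D ->
  measurable_fun D k -> cintegrable D f ->
  cintegrable D (fun s => expi (t * k s) * f s).
Proof.
move=> mD mk [i1 i2].
have mc : measurable_fun D (fun s => cos (t * k s)).
  apply: measurableT_comp; first by apply: continuous_measurable_fun; exact: continuous_cos.
  exact: measurable_funM.
have ms : measurable_fun D (fun s => sin (t * k s)).
  apply: measurableT_comp; first by apply: continuous_measurable_fun; exact: continuous_sin.
  exact: measurable_funM.
have c1 s : `|cos (t * k s)| <= 1 by exact: norm_cos_le1.
have s1 s : `|sin (t * k s)| <= 1 by exact: norm_sin_le1.
split.
- under [X in EFin \o X]eq_fun do rewrite Re_expiM.
  by apply: integrable_EFinB => //; exact: integrable_le1M.
- under [X in EFin \o X]eq_fun do rewrite Im_expiM.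
  by apply: integrable_EFinD => //; exact: integrable_le1M.
Qed.

Lemma cintegral_itvB f (r r' : R) : 0 <= r -> r <= r' -> cintegrable `[0, r'] f ->
  cintegral `[0, r'] f - cintegral `[0, r] f = cintegral `]r, r'] f.
Proof.
move=> r0 rr' [i1 i2]; rewrite /cintegral.
have CB (x y x' y' : R) : Complex x y - Complex x' y' = Complex (x - x') (y - y') by [].
by rewrite CB; congr Complex; apply: Rintegral_itvB; rewrite ?bnd_simp.
Qed.

Lemma bounded_cintegrable f D (M : R) : measurable D -> (mu D < +oo)%E ->
  cmeasurable D f -> (forall t, `|complex.Re (f t)| <= M) ->
  (forall t, `|complex.Im (f t)| <= M) ->
  cintegrable D f /\ mu.-integrable D (EFin \o (fun t => sqmod (f t))).
Proof.
move=> mD Doo [m1 m2] b1 b2.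
have bnd (u : R -> R) (K : R) : (forall t, `|u t| <= K) -> [bounded u t | t in D].
  move=> uK; exists K; split; first exact: num_real.
  by move=> K' KK' t _; apply: le_trans (uK t) (ltW KK').
split; first by split; apply: measurable_bounded_integrable => //; exact: bnd.
apply: measurable_bounded_integrable => //.
  by apply: measurable_funD; exact: measurable_funX.
apply: (bnd _ (M ^+ 2 + M ^+ 2)) => t; rewrite ger0_norm ?sqmod_ge0// /sqmod.
have M0 : 0 <= M by apply: le_trans (b1 t).
by apply: lerD; rewrite -real_normK ?num_real// ler_sqr ?nnegrE.
Qed.

End restriction.

Section half_line.
Context (R : realType).
Notation mu := (@lebesgue_measure R).
Variables (a b T : R) (f : R -> R[i]).
Hypothesis a_gt0 : 0 < a.
Hypothesis a_neq1 : a != 1.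
Hypothesis b_neq0 : b != 0.
Hypothesis T_gt0 : 0 < T.
Let I : set R := `[T, 2 * T]%classic.
Hypothesis f0 : forall t, ~ I t -> f t = 0.
Hypothesis if1 : cintegrable setT f.
Hypothesis if2 : mu.-integrable setT (EFin \o (fun t => sqmod (f t))).

Definition amplitude (a' b' : R) (g : R -> R[i]) (s : R) : R[i] :=
  real_complex R (s `^ (a' - 1)) * fourier g (phase a' b' s).

(** The truncated solution on the line, restricted to one sign of xi, with s = |xi|: [b'] will be y
    for positive and -y for negative frequencies. *)
Definition half_wave (a' b' : R) (g : R -> R[i]) (r t : R) : R[i] :=
  cintegral `[0, r] (fun s => expi (t * phase a' b' s) * amplitude a' b' g s).

Let k := phase a b.
Let F := fourier f.
Let U := amplitude a b f.

Lemma Re_real_complexM (c : R) (z : R[i]) :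
  complex.Re (real_complex R c * z) = c * complex.Re z.
Proof. by case: z => x y /=; rewrite mul0r subr0. Qed.

Lemma Im_real_complexM (c : R) (z : R[i]) :
  complex.Im (real_complex R c * z) = c * complex.Im z.
Proof. by case: z => x y /=; rewrite mul0r addr0. Qed.

Let mk D : measurable_fun D k. Proof. exact: measurable_phase. Qed.

Let Fbound := \int[mu]_t `|complex.Re (f t)| + \int[mu]_t `|complex.Im (f t)|.

Let wave_fourier tau : fourier f tau = wave -%R f tau.
Proof. by congr (cintegral _ _); apply/funext => t; rewrite mulrN (mulrC t). Qed.

Let ReF_le tau : `|complex.Re (F tau)| <= Fbound.
Proof. by rewrite /F wave_fourier; apply: wave_Re_le => //; exact: oppr_measurable. Qed.

Let ImF_le tau : `|complex.Im (F tau)| <= Fbound.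
Proof. by rewrite /F wave_fourier; apply: wave_Im_le => //; exact: oppr_measurable. Qed.

Let mReF : measurable_fun setT (fun tau => complex.Re (F tau)).
Proof. by apply: continuous_measurable_fun; exact: continuous_fourier_Re. Qed.

Let mImF : measurable_fun setT (fun tau => complex.Im (F tau)).
Proof. by apply: continuous_measurable_fun; exact: continuous_fourier_Im. Qed.

Lemma cintegrable_amplitude r : 0 <= r -> cintegrable `[0, r] (amplitude a b f).
Proof.
move=> r0; have ip := integrable_powRB1 a_gt0 r0.
have bnd (u : R -> R) : measurable_fun setT u -> (forall s, `|u s| <= Fbound) ->
    mu.-integrable `[0, r] (EFin \o (fun s => s `^ (a - 1) * u (k s))).
  move=> mu' uF; apply: (integrableMl _ ip) => //.
    by apply: measurableT_comp => //; exact: mk.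
  exists Fbound; split; first exact: num_real.
  by move=> K FK s _; apply: le_trans (uF _) (ltW FK).
split.
- under [X in EFin \o X]eq_fun do rewrite Re_real_complexM.
  exact: (bnd (fun tau => complex.Re (F tau))).
- under [X in EFin \o X]eq_fun do rewrite Im_real_complexM.
  exact: (bnd (fun tau => complex.Im (F tau))).
Qed.

Lemma half_waveE r t : half_wave a b f r t = wave k (crestrict `[0, r] U) t.
Proof. by rewrite wave_restrict. Qed.

Let iU (D : set R) (r : R) : 0 <= r -> measurable D -> D `<=` `[0, r] -> cintegrable setT (crestrict D U).
Proof.
move=> r0 mD Dr; apply: cintegrable_restrictT => //.
exact: (cintegrableS _ _ Dr (cintegrable_amplitude r0)).
Qed.

Lemma cmeasurable_half_wave D r : 0 <= r -> cmeasurable D (half_wave a b f r).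
Proof.
move=> r0; have i0 := iU r0 (measurable_itv _) (fun x => id).
have -> : half_wave a b f r = wave k (crestrict `[0, r] U).
  by apply/funext => t; rewrite half_waveE.
split; apply: measurable_funTS.
- exact: measurable_wave_Re.
- exact: measurable_wave_Im.
Qed.

Lemma half_wave_pairing p r : 0 <= r -> cintegrable setT p ->
  \int[mu]_t (complex.Re (p t) * complex.Re (half_wave a b f r t) +
              complex.Im (p t) * complex.Im (half_wave a b f r t)) =
  \int[mu]_(s in `[0, r]) (complex.Re (U s) * complex.Re (fourier p (k s)) +
              complex.Im (U s) * complex.Im (fourier p (k s))).
Proof.
move=> r0 ip; have i0 := iU r0 (measurable_itv _) (fun x => id).
under eq_Rintegral do rewrite half_waveE.
rewrite (@wave_pairing _ k _ p (@mk setT) i0 ip) [RHS]Rintegral_mkcond.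
by apply: eq_Rintegral => s _; rewrite /crestrict patchE; case: ifP => // _; rewrite !mul0r addr0.
Qed.

Lemma half_wave_bounded r : 0 <= r -> exists M : R, forall t,
  `|complex.Re (half_wave a b f r t)| <= M /\ `|complex.Im (half_wave a b f r t)| <= M.
Proof.
move=> r0; have i0 := iU r0 (measurable_itv _) (fun x => id).
exists (\int[mu]_s `|complex.Re (crestrict `[0, r] U s)| +
  \int[mu]_s `|complex.Im (crestrict `[0, r] U s)|) => t.
by rewrite half_waveE; split; [exact: (wave_Re_le (@mk setT) i0)|exact: (wave_Im_le (@mk setT) i0)].
Qed.

Lemma integrable_half_wave_pairing p r : 0 <= r -> cintegrable setT p ->
  mu.-integrable setT (EFin \o (fun t =>
    complex.Re (p t) * complex.Re (half_wave a b f r t) +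
    complex.Im (p t) * complex.Im (half_wave a b f r t))).
Proof.
move=> r0 [ip1 ip2]; have [M HM] := half_wave_bounded r0.
have [m1 m2] := cmeasurable_half_wave setT r0.
have bnd (h : R -> R) : (forall t, `|h t| <= M) -> [bounded h t | t in [set: R]].
  move=> hM; exists M; split; first exact: num_real.
  by move=> K MK t _; apply: le_trans (hM t) (ltW MK).
apply: integrable_EFinD => //.
- apply: (integrableMl measurableT ip1 m1); apply: bnd => t; exact: (HM t).1.
- apply: (integrableMl measurableT ip2 m2); apply: bnd => t; exact: (HM t).2.
Qed.

(** [f] is paired with its own wave, whose amplitude is the Fourier transform of [f] times a
    nonnegative weight. The right-hand side being a real number, finiteness of the truncated energy
    is part of the identity. *)
Lemma half_wave_energy r : 0 <= r ->
  (\int[mu]_(s in `[0%R, r]) (s `^ (a - 1) * sqmod (fourier f (phase a b s)))%:E)%E =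
  (\int[mu]_t (complex.Re (f t) * complex.Re (half_wave a b f r t) +
              complex.Im (f t) * complex.Im (half_wave a b f r t)))%:E.
Proof.
move=> r0; have E s : s `^ (a - 1) * sqmod (fourier f (phase a b s)) =
    complex.Re (U s) * complex.Re (F (k s)) + complex.Im (U s) * complex.Im (F (k s)).
  by rewrite /U /amplitude Re_real_complexM Im_real_complexM -!mulrA -mulrDr -!expr2.
rewrite half_wave_pairing// fineK; last first.
  apply: integrable_fin_num => //.
  have [i1 i2] := cintegrable_amplitude r0.
  have bnd (h : R -> R) : (forall t, `|h t| <= Fbound) -> [bounded h (k t) | t in `[0, r]].
    move=> hM; exists Fbound; split; first exact: num_real.
    by move=> K MK t _; apply: le_trans (hM _) (ltW MK).
  apply: integrable_EFinD => //.
  - apply: (integrableMl _ i1) => //; last exact: (bnd (fun tau => complex.Re (F tau))).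
    by apply: (measurableT_comp mReF); exact: mk.
  - apply: (integrableMl _ i2) => //; last exact: (bnd (fun tau => complex.Im (F tau))).
    by apply: (measurableT_comp mImF); exact: mk.
by apply: eq_integral => s _; rewrite E.
Qed.

Lemma half_waveB r r' t : 0 <= r -> r <= r' ->
  half_wave a b f r' t - half_wave a b f r t = wave k (crestrict `]r, r'] U) t.
Proof.
move=> r0 rr'; rewrite wave_restrict /half_wave cintegral_itvB//.
have r'0 : 0 <= r' by exact: le_trans rr'.
exact: (@cintegrable_expiM _ k U _ t (measurable_itv _) (@mk _) (cintegrable_amplitude r'0)).
Qed.

Section tail.
Variables (r0 e : R).
Hypothesis r0_gt0 : 0 < r0.
Hypothesis e2 : e ^+ 2 = 1.
Let C := 2 / a.
Let k' s := e * (b + a * s `^ (a - 1)).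
Hypothesis k'P : forall s, r0 <= s -> s `^ (a - 1) <= C * k' s.

Let C0 : 0 < C. Proof. by rewrite divr_gt0. Qed.

Let k'_gt0 s : r0 <= s -> 0 < k' s.
Proof.
move=> rs; have := k'P rs; have : 0 < s `^ (a - 1).
  by apply: powR_gt0; exact: lt_le_trans rs.
by move=> /lt_le_trans H /H; rewrite pmulr_rgt0.
Qed.

Let ck' s : 0 < s -> {for s, continuous k'}.
Proof.
move=> s0; apply: cvgM; first exact: cvg_cst.
apply: cvgD; first exact: cvg_cst.
by apply: cvgM; [exact: cvg_cst|exact: continuous_powR_gt0].
Qed.

Let ck s : 0 < s -> {for s, continuous k}.
Proof.
move=> s0; apply: cvgD; last exact: continuous_powR_gt0.
by apply: cvgM => //; exact: cvg_cst.
Qed.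

Let ic (h : R -> R) r r' : (forall s, 0 < s -> {for s, continuous h}) -> r0 <= r ->
  mu.-integrable `[r, r'] (EFin \o h).
Proof.
move=> ch rr; apply: continuous_compact_integrable; first exact: segment_compact.
apply: continuous_in_subspaceT => s /[!inE]/= /[!in_itv]/= /andP[rs _].
by apply: ch; apply: lt_le_trans rs; exact: lt_le_trans rr.
Qed.

Let iG (G : R -> R) r r' : continuous G -> r0 <= r ->
  mu.-integrable `[r, r'] (EFin \o (fun s => G (k s) * k' s)).
Proof.
move=> cG rr; apply: ic => // s s0.
apply: cvgM; last exact: ck'.
by apply: (@continuous_comp _ _ _ k G); [exact: ck|exact: cG].
Qed.

Let cF : continuous (fun tau => sqmod (F tau)).
Proof. exact: continuous_sqmod_fourier. Qed.

(** The weight s^(a-1) is replaced by its majorant |k'|, up to the factor [C], so that substitution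
    turns this into the mass of |F|^2 on the image of the interval. *)
Definition tail_energy r r' := \int[mu]_(s in `[r, r']) (sqmod (F (k s)) * k' s).

Lemma half_wave_tail r r' : r0 <= r -> r <= r' ->
  mu.-integrable I (EFin \o (fun t => sqmod (half_wave a b f r' t - half_wave a b f r t))) /\
  \int[mu]_(t in I) sqmod (half_wave a b f r' t - half_wave a b f r t) <=
  2 * pi * C ^+ 2 * tail_energy r r'.
Proof.
move=> rr rr'.
have r_ge0 : 0 <= r by apply: le_trans rr; exact: ltW.
have r'_ge0 : 0 <= r' by exact: le_trans rr'.
set w := fun t => half_wave a b f r' t - half_wave a b f r t.
have wE : w = wave k (crestrict `]r, r'] U) by apply/funext => t; exact: half_waveB.
have iv : cintegrable setT (crestrict `]r, r'] U).
  by apply: (iU r'_ge0) => //; apply: subset_itvr; rewrite bnd_simp.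
pose ub := \int[mu]_s `|complex.Re ((crestrict `]r, r'] U) s)| +
  \int[mu]_s `|complex.Im ((crestrict `]r, r'] U) s)|.
(* The increment is bounded on a bounded interval, so its L2 norm is known to be finite before half
   of its square is absorbed. *)
have [iw iw2] : cintegrable I w /\ mu.-integrable I (EFin \o (fun t => sqmod (w t))).
  apply: (@bounded_cintegrable _ w I ub) => //.
  - exact: measurable_itv.
  - exact: itvcc_lty.
  - rewrite wE; split; apply: measurable_funTS.
      exact: measurable_wave_Re.
    exact: measurable_wave_Im.
  - by move=> t; rewrite wE; apply: wave_Re_le.
  - by move=> t; rewrite wE; apply: wave_Im_le.
split => //.
pose p := crestrict I w.
have mI : measurable I by exact: measurable_itv.
have ip : cintegrable setT p by exact: cintegrable_restrictT.
have ip2 : mu.-integrable setT (EFin \o (fun t => sqmod (p t))).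
  by rewrite sqmod_restrict; exact: integrable_restrictT.
have p0 t : ~ I t -> p t = 0 by move=> It; rewrite /p /crestrict memNset.
have T2 : T < 2 * T by rewrite ltr_pMl// ltr1n.
have Pbound := fourier_L2_bound T2 p0 ip ip2.
set X := \int[mu]_(t in I) sqmod (w t).
have X0 : 0 <= X by apply: Rintegral_ge0 => t _; exact: sqmod_ge0.
have XE : \int[mu]_t sqmod (p t) = X by rewrite sqmod_restrict -Rintegral_mkcond.
rewrite XE in Pbound.
have pairing : X = \int[mu]_(s in `]r, r']) (s `^ (a - 1) *
   (complex.Re (F (k s)) * complex.Re (fourier p (k s)) +
    complex.Im (F (k s)) * complex.Im (fourier p (k s)))).
  transitivity (\int[mu]_t (complex.Re (p t) * complex.Re (wave k (crestrict `]r, r'] U) t) +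
              complex.Im (p t) * complex.Im (wave k (crestrict `]r, r'] U) t))).
    rewrite /X Rintegral_mkcond; apply: eq_Rintegral => t _.
    by rewrite /p /crestrict patchE wE; case: ifP => _; rewrite ?mul0r ?addr0// /sqmod !expr2.
  rewrite (@wave_pairing _ k _ p (@mk setT) iv ip) [RHS]Rintegral_mkcond.
  apply: eq_Rintegral => s _; rewrite /crestrict patchE; case: ifP => _; last by rewrite !mul0r addr0.
  by rewrite /U /amplitude Re_real_complexM Im_real_complexM mulrDr !mulrA.
(* This value makes C / 2 * lam^-1 * (2 pi) equal to 1 / 2. *)
pose lam := 2 * pi * C.
have lam0 : 0 < lam by rewrite /lam; apply: mulr_gt0 => //; apply: mulr_gt0 => //; exact: pi_gt0.
pose G1 s := sqmod (F (k s)) * k' s.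
pose G2 s := sqmod (fourier p (k s)) * k' s.
have cP : continuous (fun tau => sqmod (fourier p tau)) by exact: continuous_sqmod_fourier.
have i1 : mu.-integrable `[r, r'] (EFin \o G1) by exact: (iG (G := fun tau => sqmod (F tau))).
have i2 : mu.-integrable `[r, r'] (EFin \o G2) by exact: (iG (G := fun tau => sqmod (fourier p tau))).
have sub : `]r, r'] `<=` `[r, r'] by apply: subset_itvr; rewrite bnd_simp.
have G2X : \int[mu]_(s in `[r, r']) G2 s <= 2 * pi * X.
  rewrite -lee_fin fineK; last exact: integrable_fin_num.
  rewrite -mulr_natl in Pbound.
  have := @integral_phase_le _ a b e r r' _ _ cP (fun tau => sqmod_ge0 _) Pbound e2
    (lt_le_trans r0_gt0 rr) rr'.
  by apply=> s rs; apply: k'_gt0; exact: le_trans rs.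
(* AM-GM with weight [lam]; half of [X] is then absorbed on the left. *)
have XA : X <= C / 2 * (lam * tail_energy r r' + lam^-1 * (2 * pi * X)).
  apply: (@le_trans _ _ (C / 2 * (lam * tail_energy r r' + lam^-1 * \int[mu]_(s in `[r, r']) G2 s))); last first.
    by rewrite ler_pM2l ?divr_gt0// lerD2l ler_pM2l ?invr_gt0.
  rewrite /tail_energy -/G1 -!RintegralZl// -RintegralD//; last 2 first.
    exact: integrable_EFinZ.
    exact: integrable_EFinZ.
  rewrite -RintegralZl//; last first.
    by apply: integrable_EFinD => //; apply: integrable_EFinZ.
  rewrite -Rintegral_itv_obnd_cbnd; last first.
    apply: (@integrableS _ _ _ mu `[r, r'] `]r, r']) => //.
    by apply: integrable_EFinZ => //; apply: integrable_EFinD => //; apply: integrable_EFinZ.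
  rewrite pairing; apply: le_Rintegral => //.
  - apply: (@integrableS _ _ _ mu `[r, r'] `]r, r']) => //; apply: ic => // s s0.
    apply: cvgM; first exact: continuous_powR_gt0.
    have cRe q : cintegrable setT q ->
        {for s, continuous (fun s => complex.Re (fourier q (k s)))}.
      move=> iq; apply: (@continuous_comp _ _ _ k (fun tau => complex.Re (fourier q tau))).
        exact: ck.
      exact: continuous_fourier_Re.
    have cIm q : cintegrable setT q ->
        {for s, continuous (fun s => complex.Im (fourier q (k s)))}.
      move=> iq; apply: (@continuous_comp _ _ _ k (fun tau => complex.Im (fourier q tau))).
        exact: ck.
      exact: continuous_fourier_Im.
    by apply: cvgD; apply: cvgM; [exact: cRe|exact: cRe|exact: cIm|exact: cIm].
  - apply: (@integrableS _ _ _ mu `[r, r'] `]r, r']) => //.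
    by apply: integrable_EFinZ => //; apply: integrable_EFinD => //; apply: integrable_EFinZ.
  move=> s /= /[!in_itv]/= /andP[rs _].
  have rs0 : r0 <= s by apply: le_trans rr _; exact: ltW.
  have ks0 := k'_gt0 rs0.
  have sC := k'P rs0.
  rewrite /G1 /G2 /sqmod.
  set x := complex.Re (F _); set y := complex.Im (F _).
  set x' := complex.Re (fourier p _); set y' := complex.Im (fourier p _).
  have Q : x * x' + y * y' <= (lam * (x ^+ 2 + y ^+ 2) + lam^-1 * (x' ^+ 2 + y' ^+ 2)) / 2.
    rewrite -subr_ge0.
    have -> : (lam * (x ^+ 2 + y ^+ 2) + lam^-1 * (x' ^+ 2 + y' ^+ 2)) / 2 - (x * x' + y * y') =
      lam^-1 * ((lam * x - x') ^+ 2 + (lam * y - y') ^+ 2) / 2 by field; exact: lt0r_neq0.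
    by rewrite divr_ge0// mulr_ge0 ?invr_ge0 ?(ltW lam0)// addr_ge0 ?sqr_ge0.
  apply: (le_trans (ler_wpM2l (powR_ge0 _ _) Q)).
  have Q0 : 0 <= (lam * (x ^+ 2 + y ^+ 2) + lam^-1 * (x' ^+ 2 + y' ^+ 2)) / 2.
    by rewrite divr_ge0// addr_ge0// mulr_ge0 ?invr_ge0 ?(ltW lam0)// addr_ge0 ?sqr_ge0.
  apply: (le_trans (ler_wpM2r Q0 sC)).
  by rewrite le_eqVlt; apply/orP; left; apply/eqP; ring.
have C2 : C / 2 * (lam * tail_energy r r' + lam^-1 * (2 * pi * X)) =
    pi * C ^+ 2 * tail_energy r r' + X / 2.
  have alg (c q A Y : R) : c != 0 -> q != 0 ->
      c / 2 * (2 * q * c * A + (2 * q * c)^-1 * (2 * q * Y)) = q * c ^+ 2 * A + Y / 2.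
    by move=> c0 q0; field; rewrite c0 q0.
  by apply: alg; [exact: lt0r_neq0|rewrite gt_eqF// pi_gt0].
by move: XA; rewrite C2; lra.
Qed.

Let iW r r' : r0 <= r ->
  mu.-integrable `[r, r'] (EFin \o (fun s => sqmod (F (k s)) * k' s)).
Proof. by move=> rr; exact: (iG (G := fun tau => sqmod (F tau))). Qed.

Let T2 : T < 2 * T. Proof. by rewrite ltr_pMl// ltr1n. Qed.

Lemma tail_energy_le r r' : r0 <= r -> r <= r' ->
  tail_energy r r' <= 2 * pi * \int[mu]_t sqmod (f t).
Proof.
move=> rr rr'; rewrite -lee_fin fineK; last exact/integrable_fin_num/iW.
have Pbound := fourier_L2_bound T2 f0 if1 if2.
rewrite -mulr_natl in Pbound.
have := @integral_phase_le _ a b e r r' _ _ cF (fun tau => sqmod_ge0 _) Pbound e2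
    (lt_le_trans r0_gt0 rr) rr'.
by apply=> s rs; apply: k'_gt0; exact: le_trans rs.
Qed.

Let tail_energy_ge0 r r' : r0 <= r -> 0 <= tail_energy r r'.
Proof.
move=> rr; apply: Rintegral_ge0 => s /= /[!in_itv]/= /andP[rs _].
by rewrite mulr_ge0 ?sqmod_ge0// ltW// k'_gt0//; exact: le_trans rs.
Qed.

Let tail_energyB r r' : r0 <= r -> r <= r' ->
  tail_energy r r' = tail_energy r0 r' - tail_energy r0 r.
Proof.
move=> rr rr'; rewrite /tail_energy Rintegral_itvB ?bnd_simp//; last exact: iW.
rewrite Rintegral_itv_obnd_cbnd//.
apply: (@integrableS _ _ _ mu `[r, r'] `]r, r']) => //; last exact: iW.
by apply: subset_itvr; rewrite bnd_simp.
Qed.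

Lemma half_wave_limit_from : exists (v : R -> R[i]) (tau : R -> R),
  [/\ cmeasurable I v, tau r @[r --> +oo] --> 0 &
    forall r, r0 <= r ->
      (\int[mu]_(t in I) (sqmod (half_wave a b f r t - v t))%:E <= (tau r)%:E)%E].
Proof.
(* Tail energies are nondecreasing in the outer radius and bounded by [tail_energy_le]. Hence what
   remains beyond [r], namely [S - tail_energy r0 r], tends to 0 and provides the rate [tau]. *)
pose S := sup [set tail_energy r0 r | r in [set r | r0 <= r]].
have hS : has_sup [set tail_energy r0 r | r in [set r | r0 <= r]].
  split; first by exists (tail_energy r0 r0), r0 => //=.
  exists (2 * pi * \int[mu]_t sqmod (f t)) => _ [r /= rr <-].
  exact: tail_energy_le.
pose K := 2 * pi * C ^+ 2.
have K0 : 0 <= K by apply: mulr_ge0; [apply: mulr_ge0 => //; exact: pi_ge0|exact: sqr_ge0].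
pose tau r := K * (S - tail_energy r0 r).
have tau_tail r r' : r0 <= r -> r <= r' -> K * tail_energy r r' <= tau r.
  move=> rr rr'; rewrite /tau ler_wpM2l// tail_energyB// lerD2r.
  by apply: sup_upper_bound => //; exists r' => //=; exact: le_trans rr'.
have tau0 : tau r @[r --> +oo] --> 0.
  rewrite /tau -[X in _ --> X](mulr0 K); apply: cvgM; first exact: cvg_cst.
  apply/cvgrPdist_le => eps eps0.
  have [_ [r1 /= r01 <-] r1S] := sup_adherent eps0 hS.
  exists r1; split; first exact: num_real.
  move=> r r1r; have r0r : r0 <= r by apply: le_trans r01 _; exact: ltW.
  have Nr : tail_energy r0 r <= S by apply: sup_upper_bound => //; exists r.
  rewrite sub0r opprB ler0_norm ?subr_le0// opprB.
  have := tail_energyB r01 (ltW r1r); have := tail_energy_ge0 r r01.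
  move: r1S; rewrite -/S; lra.
have diff r r' : r0 <= r -> r <= r' ->
    (\int[mu]_(t in I) (sqmod (half_wave a b f r' t - half_wave a b f r t))%:E <= (tau r)%:E)%E.
  move=> rr rr'; have [iw le_w] := half_wave_tail rr rr'.
  rewrite -[X in (X <= _)%E]fineK; last first.
    by apply: integrable_fin_num => //; exact: measurable_itv.
  by rewrite lee_fin; apply: (le_trans le_w); exact: tau_tail.
have mI : measurable I by exact: measurable_itv.
(* Truncating the radius at [0] makes every partial wave measurable. *)
pose w r := half_wave a b f (Num.max 0 r).
have mw r : cmeasurable I (w r).
  by apply: cmeasurable_half_wave; rewrite le_max lexx.
have wE r : r0 <= r -> w r = half_wave a b f r.
  by move=> rr; rewrite /w max_r// (le_trans _ rr)// ltW.
have [v1 [mv1 v1P]] : exists v : R -> R, measurable_fun I v /\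
    forall r, r0 <= r ->
    (\int[mu]_(t in I) ((complex.Re (w r t) - v t) ^+ 2)%:E <= (tau r)%:E)%E.
  apply: (@L2_cauchy_limit _ _ _ mu I mI (fun r t => complex.Re (w r t)) r0 tau) => //.
    by move=> r; case: (mw r).
  move=> r r' rr rr'; apply: le_trans (diff _ _ rr rr').
  rewrite !wE//; last exact: le_trans rr'.
  apply: ge0_le_integral => //.
  - by move=> t _; rewrite lee_fin sqr_ge0.
  - apply/measurable_EFinP; apply: measurable_funX.
    have [m1 _] := mw r; have [m1' _] := mw r'; rewrite !wE in m1 m1' => //.
      exact: measurable_funB.
    exact: le_trans rr'.
  - by apply: measurable_EFin_sqmod; rewrite -!wE//; [exact: cmeasurableB|exact: le_trans rr'].
  - by move=> t _; rewrite lee_fin /sqmod ReB lerDl sqr_ge0.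
have [v2 [mv2 v2P]] : exists v : R -> R, measurable_fun I v /\
    forall r, r0 <= r ->
    (\int[mu]_(t in I) ((complex.Im (w r t) - v t) ^+ 2)%:E <= (tau r)%:E)%E.
  apply: (@L2_cauchy_limit _ _ _ mu I mI (fun r t => complex.Im (w r t)) r0 tau) => //.
    by move=> r; case: (mw r).
  move=> r r' rr rr'; apply: le_trans (diff _ _ rr rr').
  rewrite !wE//; last exact: le_trans rr'.
  apply: ge0_le_integral => //.
  - by move=> t _; rewrite lee_fin sqr_ge0.
  - apply/measurable_EFinP; apply: measurable_funX.
    have [_ m1] := mw r; have [_ m1'] := mw r'; rewrite !wE in m1 m1' => //.
      exact: measurable_funB.
    exact: le_trans rr'.
  - by apply: measurable_EFin_sqmod; rewrite -!wE//; [exact: cmeasurableB|exact: le_trans rr'].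
  - by move=> t _; rewrite lee_fin /sqmod ImB lerDr sqr_ge0.
(* Real and imaginary parts converge separately, each at the rate [tau]. *)
exists (fun t => Complex (v1 t) (v2 t)), (fun r => tau r + tau r); split => //.
  by rewrite -[X in _ --> X]addr0; exact: cvgD.
have sq_ge0 (u : R -> R) t : I t -> (0 <= (u t ^+ 2)%:E)%E by rewrite lee_fin sqr_ge0.
have msqr (u u' : R -> R) : measurable_fun I u -> measurable_fun I u' ->
    measurable_fun I (fun t => ((u t - u' t) ^+ 2)%:E).
  by move=> m1 m2; apply/measurable_EFinP; apply: measurable_funX; exact: measurable_funB.
move=> r rr; have [m1 m2] := mw r.
rewrite EFinD; apply: le_trans (leeD (v1P _ rr) (v2P _ rr)).
have sumE := ge0_integralD mu mI (sq_ge0 (fun t => complex.Re (w r t) - v1 t)) (msqr _ _ m1 mv1)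
  (sq_ge0 (fun t => complex.Im (w r t) - v2 t)) (msqr _ _ m2 mv2).
rewrite -[X in (_ <= X)%E]sumE.
by rewrite wE.
Qed.

End tail.

Lemma half_wave_limit : exists (v : R -> R[i]) (tau : R -> R) (r0 : R),
  [/\ cmeasurable I v, tau r @[r --> +oo] --> 0 &
    forall r, r0 <= r ->
      (\int[mu]_(t in I) (sqmod (half_wave a b f r t - v t))%:E <= (tau r)%:E)%E].
Proof.
have [r0 [e [r0_gt0 e2 k'P]]] := phase_tail a_gt0 a_neq1 b_neq0.
have [v [tau vP]] := half_wave_limit_from r0_gt0 e2 k'P.
by exists v, tau, r0.
Qed.

End half_line.

(** * Concentration near the critical point of the phase *)

Section reflection.
Context (R : realType).
Notation mu := (@lebesgue_measure R).

Lemma ge0_integral_itv_opp (f : R -> \bar R) (c : R) : measurable_fun setT f ->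
  (forall r, 0 <= f r)%E ->
  (\int[mu]_(r in `[(- c)%R, 0%R]) f r = \int[mu]_(r in `[0%R, c]) f (- r)%R)%E.
Proof.
move=> mf f0; rewrite (_ : `[0%R, c]%classic =
    (-%R : _ -> measurableTypeR R) @^-1` `[(- c)%R, 0%R]); last first.
  by rewrite opp_preimage_itvbndbnd/= oppr0 opprK.
rewrite -ge0_integral_pushforward//=; last exact: measurable_funS mf.
by apply: eq_measure_integral => //= A mA AS; exact/esym/lebesgue_measureN.
Qed.

Lemma Rintegral_itv_opp (f : R -> R) (c : R) : measurable_fun setT f ->
  \int[mu]_(r in `[(- c)%R, 0%R]) f r = \int[mu]_(r in `[0%R, c]) f (- r).
Proof.
move=> mf; rewrite /Rintegral integralE [in RHS]integralE.
have mEf : measurable_fun setT (EFin \o f) by exact/measurable_EFinP.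
congr (fine (_ - _)%E).
- have H := @ge0_integral_itv_opp ((EFin \o f)^\+)%E c (measurable_funepos mEf) (fun r => funepos_ge0 _ r).
  by apply: (etrans H); apply: eq_integral => r _; rewrite !funeposE.
- have H := @ge0_integral_itv_opp ((EFin \o f)^\-)%E c (measurable_funeneg mEf) (fun r => funeneg_ge0 _ r).
  by apply: (etrans H); apply: eq_integral => r _; rewrite !funenegE.
Qed.

End reflection.

Lemma powR_inj_gt0 (R : realType) (x y p : R) : 0 < x -> 0 < y -> p != 0 ->
  x `^ p = y `^ p -> x = y.
Proof.
move=> x0 y0 p0 xy.
by rewrite -(powRr1 (ltW x0)) -(powRr1 (ltW y0)) -(mulfV p0) !(powRrM _ p) xy.
Qed.

Section phase_lower_bound.
Context (R : realType).
Notation mu := (@lebesgue_measure R).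
Variables (a y : R).
Hypothesis a_gt0 : 0 < a.
Hypothesis a_neq1 : a != 1.
Hypothesis y_gt0 : 0 < y.

(** For the phase - y s + s^a, [s0] is the critical point, [s1] the nonzero root, [q] is s0^a, [- Z]
    the critical value and [e] the sign of the second derivative. *)
Let q := (y / a) `^ (a / (a - 1)).
Let Z := (a - 1) * q.
Let e := Num.sg (a - 1).
Let s0 := (y / a) `^ (a - 1)^-1.
Let s1 := y `^ (a - 1)^-1.
Let mlo := Num.min 1 a^-1.
Let mhi := Num.max 1 a^-1.

Let am1 : a - 1 != 0. Proof. by rewrite subr_eq0. Qed.
Let nam1 : 0 < `|a - 1|. Proof. by rewrite normr_gt0. Qed.
Let e2 : e ^+ 2 = 1. Proof. by rewrite sqr_sg am1. Qed.
Let eam1 : e * (a - 1) = `|a - 1|. Proof. by rewrite [RHS]normrEsg. Qed.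
Let ya : 0 < y / a. Proof. exact: divr_gt0. Qed.
Let s0_gt0 : 0 < s0. Proof. exact: powR_gt0. Qed.
Let s1_gt0 : 0 < s1. Proof. exact: powR_gt0. Qed.
Let q_gt0 : 0 < q. Proof. exact: powR_gt0. Qed.

Let s0E : s0 `^ (a - 1) = y / a.
Proof. by rewrite /s0 -powRrM mulVf// powRr1// ltW. Qed.

Let s1E : s1 `^ (a - 1) = y.
Proof. by rewrite /s1 -powRrM mulVf// powRr1// ltW. Qed.

Let s0aE : s0 `^ a = q.
Proof. by rewrite /s0 /q -powRrM (mulrC _ a). Qed.

Let aqE : a * q = y * s0.
Proof. by rewrite -s0aE -mulr_powRB1_gt0// s0E; field; exact: lt0r_neq0. Qed.

Let a_cases : (1 < a) \/ (a < 1).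
Proof. by move: a_neq1; rewrite neq_lt => /orP[]; [right|left]. Qed.

Let e_gt1 : 1 < a -> e = 1.
Proof. by move=> a1; rewrite /e gtr0_sg// subr_gt0. Qed.

Let e_lt1 : a < 1 -> e = -1.
Proof. by move=> a1; rewrite /e ltr0_sg// subr_lt0. Qed.

Let mono s t : 0 < s -> s <= t -> 0 <= e * (t `^ (a - 1) - s `^ (a - 1)).
Proof.
move=> s_gt0 st; have := @gt0_powR_monotone _ (a - 1) _ _ s_gt0 st.
case: a_cases => a1; rewrite subr_ge0.
  by rewrite (ltW a1) e_gt1// mul1r subr_ge0.
by rewrite leNgt a1/= e_lt1// mulN1r opprB subr_ge0.
Qed.

Let s01 : s0 < s1.
Proof.
rewrite ltNge; apply/negP => s10.
have := mono s1_gt0 s10; rewrite s0E s1E.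
have -> : e * (y / a - y) = - (`|a - 1| * y / a).
  by rewrite -eam1; field; exact: lt0r_neq0.
by apply/negP; rewrite -ltNge oppr_lt0 divr_gt0// mulr_gt0.
Qed.

Let w s := e * (a * s `^ (a - 1) - y).

Let w_ge0 s : s0 <= s -> 0 <= w s.
Proof.
move=> s0s; have := mono s0_gt0 s0s; rewrite s0E => H.
have -> : w s = a * (e * (s `^ (a - 1) - y / a)).
  by rewrite /w; field; exact: lt0r_neq0.
by rewrite mulr_ge0// ltW.
Qed.

Let w_gt0 s : s0 < s -> 0 < w s.
Proof.
move=> s0s; have s_gt0 := lt_trans s0_gt0 s0s.
rewrite lt_neqAle w_ge0 ?(ltW s0s)// andbT eq_sym /w mulf_neq0//.
  by rewrite sgr_eq0.
rewrite subr_eq0; apply/eqP => H.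
have sE : s `^ (a - 1) = s0 `^ (a - 1).
  by rewrite s0E -H; field; exact: lt0r_neq0.
have ss0 := powR_inj_gt0 s_gt0 s0_gt0 am1 sE.
by move: s0s; rewrite ss0 ltxx.
Qed.

(** On this interval s^(a-1) runs from y / a to y, increasing or decreasing according to whether a >
    1; this is the origin of the minimum [mlo] and the maximum [mhi] of 1 and 1 / a. *)
Let powlo s : s0 <= s -> s <= s1 -> mlo * y <= s `^ (a - 1).
Proof.
move=> s0s ss1; have := mono s0_gt0 s0s.
have := mono (lt_le_trans s0_gt0 s0s) ss1; rewrite s0E s1E.
case: a_cases => a1; rewrite ?(e_gt1 a1) ?(e_lt1 a1) ?mul1r ?mulN1r => H1 H2.
  apply: (@le_trans _ _ (a^-1 * y)); last by rewrite mulrC -subr_ge0.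
  by rewrite ler_pM2r// /mlo ge_min lexx orbT.
apply: (@le_trans _ _ (1 * y)); last by rewrite mul1r; lra.
by rewrite ler_pM2r// /mlo ge_min lexx.
Qed.

Let powhi s : s0 <= s -> s <= s1 -> s `^ (a - 1) <= mhi * y.
Proof.
move=> s0s ss1; have := mono s0_gt0 s0s.
have := mono (lt_le_trans s0_gt0 s0s) ss1; rewrite s0E s1E.
case: a_cases => a1; rewrite ?(e_gt1 a1) ?(e_lt1 a1) ?mul1r ?mulN1r => H1 H2.
  apply: (@le_trans _ _ (1 * y)); first by rewrite mul1r -subr_ge0.
  by rewrite ler_pM2r// /mhi le_max lexx.
apply: (@le_trans _ _ (a^-1 * y)); first by rewrite mulrC; lra.
by rewrite ler_pM2r// /mhi le_max lexx orbT.
Qed.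

(* The distance of the phase to its critical value [- Z]. *)
Let z s := e * (phase a (- y) s + Z).

Let z_s0 : z s0 = 0.
Proof.
rewrite /z /phase s0aE /Z; have -> : - y * s0 + q + (a - 1) * q = a * q - y * s0 by ring.
by rewrite aqE subrr mulr0.
Qed.

Let z_s1 : z s1 = `|Z|.
Proof.
rewrite /z /phase -mulr_powRB1_gt0// s1E /Z normrM (gtr0_norm q_gt0) -eam1.
by rewrite mulNr mulrC (mulrC s1) addNr add0r mulrC mulrA.
Qed.

Let dz (s : R) : 0 < s -> is_derive s 1 z (w s).
Proof.
move=> s_gt0; have D := is_derive_phase a (- y) s_gt0.
have D2 : is_derive s 1 (fun s => phase a (- y) s + Z) (- y + a * s `^ (a - 1)).
  rewrite -[X in is_derive _ _ _ X]addr0.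
  exact: (@is_deriveD _ _ _ (phase a (- y)) (cst Z) s 1).
rewrite /w (addrC (a * _)).
exact: (@is_deriveZ _ _ _ (fun s => phase a (- y) s + Z) e s 1 _ D2).
Qed.

Let w' s := a * `|a - 1| * s `^ (a - 1 - 1).

Let dw (s : R) : 0 < s -> is_derive s 1 w (w' s).
Proof.
move=> s_gt0; have D := is_derive1_powR (a - 1) s_gt0.
have D1 := @is_deriveZ _ _ _ (fun s : R => s `^ (a - 1)) a s 1 _ D.
have D2 := @is_deriveD _ _ _ _ (cst (- y)) s 1 _ _ D1 (is_derive_cst _ _ _).
have D3 := @is_deriveZ _ _ _ _ e s 1 _ D2.
have -> : w' s = e *: (a *: ((a - 1) * s `^ (a - 1 - 1)) + 0).
  by rewrite /w' -eam1 /GRing.scale/=; ring.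
exact: D3.
Qed.

Let cont_of (h h' : R -> R) : (forall s : R, 0 < s -> is_derive s 1 h (h' s)) ->
  forall s : R, 0 < s -> {for s, continuous h}.
Proof.
move=> dh s s_gt0; apply/differentiable_continuous/derivable1_diffP.
by have := dh _ s_gt0 => -[].
Qed.

(** Chosen so that 2 c w' <= 1 between [s0] and [s1], where s^(a-2) is at most mhi y / s0. *)
Let c := s0 / (2 * a * `|a - 1| * mhi * y).

Let mhi_gt0 : 0 < mhi. Proof. by rewrite /mhi lt_max ltr01. Qed.
Let mlo_gt0 : 0 < mlo. Proof. by rewrite /mlo lt_min ltr01 invr_gt0. Qed.

Let den_gt0 : 0 < 2 * a * `|a - 1| * mhi * y.
Proof. by do ?[apply: mulr_gt0 => //]. Qed.

Let c_gt0 : 0 < c. Proof. exact: divr_gt0. Qed.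

(** Since [w] is the derivative of [z], the difference z - c w^2 has derivative w (1 - 2 c w'),
    nonnegative by the choice of [c]; at the critical point both [z] and [w] vanish. *)
Lemma sqr_phase_derivative_le s : s0 <= s -> s <= s1 -> c * w s ^+ 2 <= z s.
Proof.
move=> s0s ss1.
pose D t := z t - c * w t ^+ 2.
have dD (t : R) : 0 < t -> is_derive t 1 D (w t * (1 - 2 * c * w' t)).
  move=> t_gt0; have D1 := dz t_gt0; have D2 := dw t_gt0.
  have D3 := @is_deriveM _ _ w w t 1 _ _ D2 D2.
  have D4 := @is_deriveZ _ _ _ _ c t 1 _ D3.
  have D5 := @is_deriveB _ _ _ _ _ t 1 _ _ D1 D4.
  have -> : w t * (1 - 2 * c * w' t) = w t - c *: (w t *: w' t + w t *: w' t).
    by rewrite /GRing.scale/=; ring.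
  exact: D5.
have gt0 t : s0 <= t -> 0 < t by exact: lt_le_trans.
have : D s0 <= D s.
  apply: (@ger0_derive1_ndecr _ D s0 s1 _ _ _ s0 s (lexx s0) s0s ss1).
  - by move=> t; rewrite in_itv/= => /andP[/ltW/gt0 t0 _]; have := dD _ t0 => -[].
  - move=> t; rewrite in_itv/= => /andP[/ltW s0t /ltW ts1]; have t0 := gt0 _ s0t.
    rewrite derive1E; have Dt := dD _ t0; rewrite derive_val.
    rewrite mulr_ge0 ?w_ge0// subr_ge0 /w' /c.
    have H : t `^ (a - 1 - 1) <= mhi * y / s0.
      rewrite ler_pdivlMr// (le_trans _ (powhi s0t ts1))//.
      by rewrite -(mulr_powRB1_gt0 (a - 1) t0) mulrC ler_pM2r ?powR_gt0.
    have -> : 2 * (s0 / (2 * a * `|a - 1| * mhi * y)) * (a * `|a - 1| * t `^ (a - 1 - 1)) =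
      t `^ (a - 1 - 1) / (mhi * y / s0).
      by field; rewrite !lt0r_neq0//.
    by rewrite ler_pdivrMr ?mul1r// divr_gt0// mulr_gt0.
  - apply: continuous_in_subspaceT => t /[!inE]/= /[!in_itv]/= /andP[/gt0 t0 _].
    exact: (cont_of dD).
rewrite /D z_s0 /w s0E; have -> : a * (y / a) - y = 0 by field; exact: lt0r_neq0.
by rewrite mulr0 expr0n mulr0 subrr subr_ge0.
Qed.

(** The factor mlo y bounds the amplitude from below, and sqrt c compensates z^(-1/2) w <=
    c^(-1/2). *)
Let K := mlo * y * Num.sqrt c.

Let z_gt0 s : s0 < s -> s <= s1 -> 0 < z s.
Proof.
move=> s0s ss1; apply: lt_le_trans (sqr_phase_derivative_le (ltW s0s) ss1).
by rewrite mulr_gt0// exprn_gt0// w_gt0.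
Qed.

Let pointwise s : s0 < s -> s <= s1 -> K * (z s `^ (- 2^-1) * w s) <= s `^ (a - 1).
Proof.
move=> s0s ss1; apply: le_trans (powlo (ltW s0s) ss1).
have z0 := z_gt0 s0s ss1.
rewrite /K -mulrA -[leRHS]mulr1 ler_pM2l ?mulr_gt0//.
rewrite powRN powR12_sqrt ?(ltW z0)// mulrCA mulrC ler_pdivrMr ?sqrtr_gt0// mul1r.
have w0 : 0 <= Num.sqrt c * w s by apply: mulr_ge0; [exact: sqrtr_ge0|exact/w_ge0/ltW].
rewrite -ler_sqr ?nnegrE ?sqrtr_ge0//.
rewrite exprMn !sqr_sqrtr ?(ltW z0) ?(ltW c_gt0)//.
exact: (sqr_phase_derivative_le (ltW s0s)).
Qed.

(** The relation a q = y s0 turns c y^2 into q / (2 |a - 1| mhi), so that the whole dependence on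
    [y] sits in the square root of [q]. *)
Let KE : K = mlo / Num.sqrt (2 * `|a - 1| * mhi) * a^-1 `^ (a / (2 * (a - 1))) *
  y `^ (a / (2 * (a - 1))).
Proof.
have h0 : 0 < 2 * `|a - 1| * mhi by rewrite !mulr_gt0.
have qE : Num.sqrt q = a^-1 `^ (a / (2 * (a - 1))) * y `^ (a / (2 * (a - 1))).
  rewrite -powRM ?invr_ge0 ?ltW// (mulrC a^-1) -powR12_sqrt ?(ltW q_gt0)// /q -powRrM.
  by congr (_ `^ _); rewrite invfM mulrCA mulrC mulrA.
rewrite -mulrA -qE /K.
apply/eqP; rewrite -(eqrXn2 (n := 2))//; last 2 first.
- by rewrite !mulr_ge0 ?sqrtr_ge0// ltW.
- by rewrite !mulr_ge0 ?invr_ge0 ?sqrtr_ge0// ltW.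
rewrite !exprMn exprVn !sqr_sqrtr ?(ltW q_gt0) ?(ltW c_gt0) ?(ltW h0)//.
have -> : q = y * s0 / a by rewrite -aqE; field; exact: lt0r_neq0.
by rewrite /c; apply/eqP; field; rewrite !lt0r_neq0.
Qed.

Variable G : R -> R.
Hypothesis cG : continuous G.
Hypothesis G_ge0 : forall x, 0 <= G x.

Let mcomp (D : set R) (h : R -> R) : measurable_fun setT h ->
  measurable_fun D (fun s => G (h s)).
Proof.
move=> mh; apply: measurable_funTS; apply: measurableT_comp mh.
exact: continuous_measurable_fun.
Qed.

Lemma phase_energy_lower_bound :
  ((mlo / Num.sqrt (2 * `|a - 1| * mhi) * a^-1 `^ (a / (2 * (a - 1))) *
     y `^ (a / (2 * (a - 1))))%:E *
   \int[mu]_(x in `[0%R, `|Z|%R]) (x `^ (- 2^-1) * G (e * x - Z)%R)%:E <=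
   \int[mu]_(s in `[0%R, s1]) (s `^ (a - 1) * G (phase a (- y)%R s))%:E)%E.
Proof.
rewrite -KE.
have K0 : 0 < K by rewrite !mulr_gt0 ?sqrtr_gt0.
have mpow (p : R) : measurable_fun setT (fun s : R => s `^ p) by exact: measurable_powR.
set rhs := (X in (_ <= X)%E).
have rhs0 : (0 <= rhs)%E.
  by apply: integral_ge0 => s _; rewrite lee_fin mulr_ge0 ?powR_ge0.
suff H : (\int[mu]_(x in `[0%R, `|Z|%R]) (K * (x `^ (- 2^-1) * G (e * x - Z)%R))%:E <= rhs)%E.
  apply: le_trans H; under [X in (_ <= X)%E]eq_integral do rewrite EFinM.
  rewrite ge0_integralZl_EFin//; last by rewrite ltW.
    by move=> x _; rewrite lee_fin mulr_ge0 ?powR_ge0.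
  apply/measurable_EFinP; apply: measurable_funM; first exact: measurable_funTS.
  by apply: mcomp; apply: measurable_funB => //; exact: mulrl_measurable.
apply: ge0_integral_itv0c_le => //.
- apply: measurable_funM => //; apply: measurable_funM => //.
  by apply: mcomp; apply: measurable_funB => //; exact: mulrl_measurable.
- by move=> x; rewrite !mulr_ge0 ?powR_ge0// ltW.
move=> d d0 dZ.
(* The integrand x^(-1/2) is singular at z s0 = 0. Starting the substitution at [eps] keeps it
   continuous, while z eps < d ensures that [d, |Z|] is covered. *)
have [eps [s0eps eps1 zeps]] : exists eps, [/\ s0 < eps, eps <= s1 & z eps < d].
  have : \forall eps \near s0^'+, [/\ s0 < eps, eps <= s1 & z eps < d].
    have cz : z t @[t --> s0^'+] --> z s0.
      by apply: cvg_at_right_filter; exact: (cont_of dz).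
    near=> eps; split; near: eps.
    - exact: nbhs_right_gt.
    - exact: nbhs_right_le.
    - by move: cz; rewrite z_s0 => /(cvgr_lt 0); apply.
  by move=> /filter_ex.
have eps_gt0 := lt_trans s0_gt0 s0eps.
have gts0 s : s \in `[eps, s1] -> s0 < s.
  by rewrite in_itv/= => /andP[es _]; exact: lt_le_trans es.
have gts s : s \in `[eps, s1] -> 0 < s by move=> /gts0; exact: lt_trans.
have lts s : s \in `[eps, s1] -> s <= s1 by rewrite in_itv/= => /andP[].
have incr : {in `[eps, s1] &, {homo z : s t / s < t}}.
  move=> s t sI tI st.
  have es : eps <= s by move: sI; rewrite in_itv/= => /andP[].
  apply: (@gtr0_derive1_incr _ z eps s1 _ _ _ s t es st (lts _ tI)).
  - by move=> u /subset_itv_oo_cc/gts u0; have := dz u0 => -[].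
  - move=> u /subset_itv_oo_cc uI; rewrite derive1E; have Du := dz (gts _ uI).
    by rewrite derive_val; exact/w_gt0/gts0.
  - apply: continuous_in_subspaceT => u /[!inE] uI; apply: (cont_of dz); exact: gts.
have zepsgt0 : 0 < z eps by exact: z_gt0.
pose g x := K * (x `^ (- 2^-1) * G (e * x - Z)).
have cg : {within `[z eps, z s1], continuous g}.
  apply: continuous_in_subspaceT => x /[!inE]/= /[!in_itv]/= /andP[ex _].
  apply: cvgM; first exact: cvg_cst.
  apply: cvgM; first by apply: continuous_powR_gt0; exact: lt_le_trans ex.
  apply: (@continuous_comp _ _ _ (fun x : R => e * x - Z) G); last exact: cG.
  by apply: cvgB; last exact: cvg_cst; apply: cvgM => //; exact: cvg_cst.
have := @integration_by_substitution_C1 _ z w g eps s1 eps1 incr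
  (fun s sI => dz (gts s sI)) (fun s sI => cont_of dw (gts s sI)) cg.
rewrite z_s1 => subst.
apply: (@le_trans _ _ (\int[mu]_(x in `[z eps, `|Z|%R]) (g x)%:E)%E).
  apply: ge0_subset_integral => //.
  - apply/measurable_EFinP; apply: measurable_funTS.
    apply: measurable_funM => //; apply: measurable_funM => //.
    by apply: mcomp; apply: measurable_funB => //; exact: mulrl_measurable.
  - by move=> x _; rewrite lee_fin !mulr_ge0 ?powR_ge0// ltW.
  - by apply: subset_itvr; rewrite bnd_simp ltW.
rewrite [X in (X <= _)%E]subst.
apply: (@le_trans _ _ (\int[mu]_(s in `[eps, s1]) (s `^ (a - 1) * G (phase a (- y)%R s))%:E)%E).
  have mz : measurable_fun setT z.
    apply: measurable_funM => //; apply: measurable_funD => //; exact: measurable_phase.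
  have mw : measurable_fun setT w.
    by apply: measurable_funM => //; apply: measurable_funB => //; apply: measurable_funM.
  apply: ge0_le_integral => //.
  - move=> s /= sI; rewrite lee_fin /g; apply: mulr_ge0; last exact/w_ge0/ltW/gts0.
    apply: mulr_ge0; first exact: ltW.
    by apply: mulr_ge0; [exact: powR_ge0|exact: G_ge0].
  - apply/measurable_EFinP; apply: measurable_funTS; apply: measurable_funM => //.
    apply: measurable_funM => //; apply: measurable_funM.
      exact: (measurableT_comp (mpow (- 2^-1)) mz).
    by apply: mcomp; apply: measurable_funB => //; apply: measurable_funM.
  - apply/measurable_EFinP; apply: measurable_funM; first exact: measurable_funTS.
    by apply: mcomp; exact: measurable_phase.
  - move=> s /= sI; rewrite lee_fin /g.
    have -> : e * z s - Z = phase a (- y) s by rewrite /z mulrA -expr2 e2 mul1r addrK.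
    have -> : K * (z s `^ (- 2^-1) * G (phase a (- y) s)) * w s =
      K * (z s `^ (- 2^-1) * w s) * G (phase a (- y) s) by ring.
    by rewrite ler_wpM2r// pointwise//; [exact: gts0|exact: lts].
apply: ge0_subset_integral => //.
- apply/measurable_EFinP; apply: measurable_funM; first exact: measurable_funTS.
  by apply: mcomp; exact: measurable_phase.
- by move=> s _; rewrite lee_fin mulr_ge0 ?powR_ge0.
- by apply: subset_itvr; rewrite bnd_simp ltW.
Unshelve. all: by end_near. Qed.

End phase_lower_bound.

(** * The trace of the solution on a line *)

Section symmetric_interval.
Context (R : realType).
Notation mu := (@lebesgue_measure R).
Implicit Type c : R.

Let itv_symE c : 0 <= c ->
  `[- c, c]%classic = `[- c, 0]%classic `|` `]0, c]%classic :> set R.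
Proof.
by move=> c0; rewrite (@itv_bndbnd_setU _ _ _ (BRight 0))// bnd_simp// oppr_le0.
Qed.

Lemma ge0_integral_itv_sym (f : R -> R) c : 0 <= c -> measurable_fun setT f ->
  (forall x, 0 <= f x) ->
  (\int[mu]_(x in `[(- c)%R, c]) (f x)%:E =
   \int[mu]_(x in `[0%R, c]) (f x)%:E + \int[mu]_(x in `[0%R, c]) (f (- x)%R)%:E)%E.
Proof.
move=> c0 mf f0; have mEf : measurable_fun setT (EFin \o f) by exact/measurable_EFinP.
rewrite itv_symE// ge0_integral_setU//=; last 3 first.
- exact: measurable_funTS.
- by move=> x _; rewrite lee_fin.
- apply/disj_setPS => x [/=]; rewrite !in_itv/= => /andP[_ x0] /andP[].
  by rewrite ltNge x0.
rewrite (ge0_integral_itv_opp c mEf); last by move=> x; rewrite lee_fin.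
rewrite addeC integral_itv_obnd_cbnd//.
exact: measurable_funTS.
Qed.

Lemma integrable_itv_sym (h : R -> R) c : 0 <= c -> measurable_fun setT h ->
  mu.-integrable `[0, c] (EFin \o h) ->
  mu.-integrable `[0, c] (EFin \o (fun x => h (- x))) ->
  mu.-integrable `[- c, c] (EFin \o h).
Proof.
move=> c0 mh /integrableP[_ i1] /integrableP[_ i2]; apply/integrableP; split.
  by apply/measurable_EFinP; exact: measurable_funTS.
rewrite [X in (X < _)%E](@ge0_integral_itv_sym (fun x => `|h x|) c c0)//.
  exact: lte_add_pinfty.
exact: measurableT_comp.
Qed.

Lemma Rintegral_itv_sym (h : R -> R) c : 0 <= c -> measurable_fun setT h ->
  mu.-integrable `[0, c] (EFin \o h) ->
  mu.-integrable `[0, c] (EFin \o (fun x => h (- x))) ->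
  \int[mu]_(x in `[- c, c]) h x =
  \int[mu]_(x in `[0, c]) h x + \int[mu]_(x in `[0, c]) h (- x).
Proof.
move=> c0 mh i1 i2; have i := integrable_itv_sym c0 mh i1 i2.
rewrite -(Rintegral_itv_opp c mh).
have sub : `]0, c]%classic `<=` `[- c, c].
  by apply: subset_itvr; rewrite bnd_simp oppr_le0.
rewrite -[X in X + _]Rintegral_itv_obnd_cbnd; last first.
  exact: (@integrableS _ _ _ mu `[- c, c] `]0, c]).
by rewrite -(Rintegral_itvB i) ?bnd_simp ?oppr_le0// subrK.
Qed.

End symmetric_interval.

Section propagator.
Context (R : realType).
Notation mu := (@lebesgue_measure R).
Implicit Types (v : R -> R[i]) (z : R[i]).

Lemma sqmod_real_complexM (c : R) z : sqmod (real_complex R c * z) = c ^+ 2 * sqmod z.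
Proof. by rewrite /sqmod Re_real_complexM Im_real_complexM !exprMn mulrDr. Qed.

Lemma sqmodD_le z z' : sqmod (z + z') <= 2 * sqmod z + 2 * sqmod z'.
Proof.
rewrite /sqmod ReD ImD; set a1 := complex.Re z; set b1 := complex.Im z.
set a2 := complex.Re z'; set b2 := complex.Im z'; rewrite -subr_ge0.
have -> : 2 * (a1 ^+ 2 + b1 ^+ 2) + 2 * (a2 ^+ 2 + b2 ^+ 2) - ((a1 + a2) ^+ 2 + (b1 + b2) ^+ 2) =
  (a1 - a2) ^+ 2 + (b1 - b2) ^+ 2 by ring.
by rewrite addr_ge0 ?sqr_ge0.
Qed.

Variables (a y T : R) (f : R -> R[i]).
Hypothesis a_gt0 : 0 < a.
Hypothesis a_neq1 : a != 1.
Hypothesis y_neq0 : y != 0.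
Hypothesis T_gt0 : 0 < T.
Let I : set R := `[T, 2 * T]%classic.
Hypothesis f0 : forall t, ~ I t -> f t = 0.
Hypothesis if1 : cintegrable setT f.
Hypothesis if2 : mu.-integrable setT (EFin \o (fun t => sqmod (f t))).
Variable u0hat : R -> R[i].
Hypothesis u0hatE : forall xi, u0hat xi =
  real_complex R (`|xi| `^ (a - 1)) * fourier f (y * xi + `|xi| `^ a).

Let yN_neq0 : - y != 0. Proof. by rewrite oppr_eq0. Qed.

Let k xi := y * xi + `|xi| `^ a.

Let mk : measurable_fun setT k.
Proof.
apply: measurable_funD; first exact: mulrl_measurable.
exact: (measurableT_comp (measurable_powR _)).
Qed.

Let mpow p : measurable_fun setT (fun xi : R => `|xi| `^ p).
Proof. exact: (measurableT_comp (measurable_powR _)). Qed.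

Let mReF : measurable_fun setT (fun tau => complex.Re (fourier f tau)).
Proof. by apply: continuous_measurable_fun; exact: continuous_fourier_Re. Qed.

Let mImF : measurable_fun setT (fun tau => complex.Im (fourier f tau)).
Proof. by apply: continuous_measurable_fun; exact: continuous_fourier_Im. Qed.

Let mReU : measurable_fun setT (fun xi => complex.Re (u0hat xi)).
Proof.
under eq_fun do rewrite u0hatE Re_real_complexM.
by apply: measurable_funM => //; exact: (measurableT_comp mReF).
Qed.

Let mImU : measurable_fun setT (fun xi => complex.Im (u0hat xi)).
Proof.
under eq_fun do rewrite u0hatE Im_real_complexM.
by apply: measurable_funM => //; exact: (measurableT_comp mImF).
Qed.

Lemma propagator_cut_half_wave r t : 0 <= r ->
  propagator_cut a u0hat r t (y * t) = half_wave a y f r t + half_wave a (- y) f r t.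
Proof.
move=> r0.
pose h xi := expi (t * k xi) * u0hat xi.
have hE : (fun xi => expi (y * t * xi + t * `|xi| `^ a) * u0hat xi) = h.
  by apply/funext => xi; rewrite /h /k; congr (expi _ * _); ring.
have h1 s : s \in `[0, r] -> h s = expi (t * phase a y s) * amplitude a y f s.
  rewrite in_itv/= => /andP[s0 _].
  by rewrite /h /k u0hatE /amplitude /phase ger0_norm.
have h2 s : s \in `[0, r] -> h (- s) = expi (t * phase a (- y) s) * amplitude a (- y) f s.
  rewrite in_itv/= => /andP[s0 _].
  by rewrite /h /k u0hatE /amplitude /phase normrN ger0_norm// mulrN mulNr.
have mcos : measurable_fun setT (fun xi => cos (t * k xi)).
  apply: measurableT_comp; first by apply: continuous_measurable_fun; exact: continuous_cos.
  exact: measurable_funM.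
have msin : measurable_fun setT (fun xi => sin (t * k xi)).
  apply: measurableT_comp; first by apply: continuous_measurable_fun; exact: continuous_sin.
  exact: measurable_funM.
have mh1 : measurable_fun setT (fun xi => complex.Re (h xi)).
  under eq_fun do rewrite Re_expiM.
  by apply: measurable_funB; exact: measurable_funM.
have mh2 : measurable_fun setT (fun xi => complex.Im (h xi)).
  under eq_fun do rewrite Im_expiM.
  by apply: measurable_funD; exact: measurable_funM.
have ihw b : cintegrable `[0, r] (fun s => expi (t * phase a b s) * amplitude a b f s).
  apply: (@cintegrable_expiM _ (phase a b) (amplitude a b f) `[0, r] t) => //.
    exact: measurable_phase.
  exact: cintegrable_amplitude.
have [p1 p2] := ihw y; have [n1 n2] := ihw (- y).
have ip1 : mu.-integrable `[0, r] (EFin \o (fun xi => complex.Re (h xi))).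
  by apply: eq_integrable p1 => // s /[!inE] /h1 /= ->.
have ip2 : mu.-integrable `[0, r] (EFin \o (fun xi => complex.Im (h xi))).
  by apply: eq_integrable p2 => // s /[!inE] /h1 /= ->.
have in1 : mu.-integrable `[0, r] (EFin \o (fun xi => complex.Re (h (- xi)))).
  by apply: eq_integrable n1 => // s /[!inE] /h2 /= ->.
have in2 : mu.-integrable `[0, r] (EFin \o (fun xi => complex.Im (h (- xi)))).
  by apply: eq_integrable n2 => // s /[!inE] /h2 /= ->.
rewrite /propagator_cut hE /cintegral /half_wave /cintegral.
rewrite (Rintegral_itv_sym r0 mh1 ip1 in1) (Rintegral_itv_sym r0 mh2 ip2 in2).
have CD (p q p' q' : R) : Complex p q + Complex p' q' = Complex (p + p') (q + q') by [].
rewrite CD; congr Complex; congr (_ + _); apply: eq_Rintegral => s /[!inE] sI.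
- by rewrite h1.
- by rewrite h2.
- by rewrite h1.
- by rewrite h2.
Qed.

Let line_cut r t := propagator_cut a u0hat r t (y * t).

Let line_cutE r : 0 <= r ->
  line_cut r = fun t => half_wave a y f r t + half_wave a (- y) f r t.
Proof. by move=> r0; apply/funext => t; exact: propagator_cut_half_wave. Qed.

Lemma trace_on_line_exists : exists v, trace_on_line a u0hat T y v.
Proof.
have [v1 [tau1 [r1 [mv1 tau1_0 v1P]]]] :=
  half_wave_limit a_gt0 a_neq1 y_neq0 T_gt0 f0 if1 if2.
have [v2 [tau2 [r2 [mv2 tau2_0 v2P]]]] :=
  half_wave_limit a_gt0 a_neq1 yN_neq0 T_gt0 f0 if1 if2.
exists (fun t => v1 t + v2 t); split.
  exact: cmeasurableD.
pose tau r := 2 * tau1 r + 2 * tau2 r.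
have tau0 : tau r @[r --> +oo] --> 0.
  have : tau r @[r --> +oo] --> (2 * 0 + 2 * 0 : R).
    by apply: cvgD; apply: cvgM => //; exact: cvg_cst.
  by rewrite !mulr0 addr0.
have sqrt0 : (Num.sqrt (tau r))%:E @[r --> +oo] --> 0%E.
  apply: cvg_EFin; first exact: nearW.
  rewrite -[X in _ --> X](sqrtr0 R).
  exact: (@cvg_comp _ _ _ tau Num.sqrt _ _ _ tau0 (@sqrt_continuous R 0)).
apply: (@squeeze_cvge _ _ _ _ (cst 0%E) _ (fun r => (Num.sqrt (tau r))%:E)) => //; last first.
  exact: cvg_cst.
near=> r.
have r0 : 0 <= r by near: r; exact: nbhs_pinfty_ge.
have rr1 : r1 <= r by near: r; apply: nbhs_pinfty_ge; exact: num_real.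
have rr2 : r2 <= r by near: r; apply: nbhs_pinfty_ge; exact: num_real.
rewrite poweR_ge0/= /L2norm.
under eq_integral do rewrite cmodulus_sqr.
have mw1 := cmeasurable_half_wave y a_gt0 if1 I r0.
have mw2 := cmeasurable_half_wave (- y) a_gt0 if1 I r0.
have mI : measurable I by exact: measurable_itv.
have msq (w v : R -> R[i]) : cmeasurable I w -> cmeasurable I v ->
    measurable_fun I (fun t => (sqmod (w t - v t))%:E).
  by move=> mw mv; apply: measurable_EFin_sqmod; exact: cmeasurableB.
have H : (\int[mu]_(t in I) (sqmod (propagator_cut a u0hat r t (y * t) - (v1 t + v2 t)))%:E
    <= (tau r)%:E)%E.
  rewrite /tau EFinD !EFinM.
  apply: le_trans (leeD (lee_wpmul2l _ (v1P _ rr1)) (lee_wpmul2l _ (v2P _ rr2))) => //.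
  have m1 : measurable_fun I (fun t => (sqmod (half_wave a y f r t - v1 t))%:E) by exact: msq.
  have m2 : measurable_fun I (fun t => (sqmod (half_wave a (- y) f r t - v2 t))%:E) by exact: msq.
  rewrite -!ge0_integralZl_EFin//; [|by move=> t _; rewrite lee_fin sqmod_ge0..].
  rewrite -ge0_integralD//; last 4 first.
  - by move=> t _; rewrite mule_ge0// lee_fin sqmod_ge0.
  - by apply: emeasurable_funM.
  - by move=> t _; rewrite mule_ge0// lee_fin sqmod_ge0.
  - by apply: emeasurable_funM.
  apply: ge0_le_integral => //.
  - by move=> t _; rewrite lee_fin sqmod_ge0.
  - apply: (msq (line_cut r) (fun t => v1 t + v2 t)); last exact: cmeasurableD.
    by rewrite line_cutE//; exact: cmeasurableD.
  - by apply: emeasurable_funD; apply: emeasurable_funM.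
  - move=> t _; rewrite -!EFinM -EFinD lee_fin propagator_cut_half_wave//.
    by rewrite opprD addrACA; exact: sqmodD_le.
have tau_ge0 : 0 <= tau r.
  rewrite -lee_fin; apply: le_trans H; apply: integral_ge0 => t _.
  by rewrite lee_fin sqmod_ge0.
rewrite -powR12_sqrt// -poweR_EFin; apply: gt0_ler_poweR => //.
- by rewrite in_itv/= leey andbT integral_ge0// => t _; rewrite lee_fin sqmod_ge0.
- by rewrite in_itv/= leey andbT lee_fin.
Unshelve. all: by end_near. Qed.

Definition energy_density xi := `|xi| `^ (a - 1) * sqmod (fourier f (y * xi + `|xi| `^ a)).

Lemma energy_density_ge0 xi : 0 <= energy_density xi.
Proof. by rewrite mulr_ge0 ?powR_ge0 ?sqmod_ge0. Qed.

Lemma measurable_energy_density : measurable_fun setT energy_density.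
Proof.
have mF : measurable_fun setT (fun tau => sqmod (fourier f tau)).
  by apply: continuous_measurable_fun; exact: continuous_sqmod_fourier.
exact: (measurable_funM (mpow _) (measurableT_comp mF mk)).
Qed.

Lemma hdot_norm_energy :
  hdot_norm ((1 - a) / 2) u0hat = ((\int[mu]_xi (energy_density xi)%:E) `^ 2^-1)%E.
Proof.
rewrite /hdot_norm; congr (_ `^ _)%E; apply: eq_integral => xi _; congr EFin.
rewrite cmodulus_sqr u0hatE sqmod_real_complexM mulrA /energy_density; congr (_ * _).
have -> : 2 * ((1 - a) / 2) = 1 - a by field.
(* At xi = 0 the exponents cannot be added, but they are nonzero because a != 1, so both sides
   vanish. *)
have [->|xi0] := eqVneq xi 0.
  by rewrite normr0 !powR0 ?mul0r// subr_eq0// eq_sym.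
have n0 : `|xi| != 0 by rewrite normr_eq0.
rewrite expr2 mulrA -powRD; last by rewrite n0 implybT.
by rewrite (_ : 1 - a + (a - 1) = 0) ?powRr0 ?mul1r//; ring.
Qed.

Let energy_pairing n : 0 <= n ->
  (\int[mu]_(xi in `[(- n)%R, n]) (energy_density xi)%:E)%E =
  (\int[mu]_t (complex.Re (f t) * complex.Re (line_cut n t) +
               complex.Im (f t) * complex.Im (line_cut n t)))%:E.
Proof.
move=> n0.
transitivity (\int[mu]_(s in `[0%R, n]) (s `^ (a - 1) * sqmod (fourier f (phase a y s)))%:E +
  \int[mu]_(s in `[0%R, n]) (s `^ (a - 1) * sqmod (fourier f (phase a (- y)%R s)))%:E)%E.
  apply: etrans (ge0_integral_itv_sym n0 measurable_energy_density energy_density_ge0) _.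
  apply: f_equal2; apply: eq_integral => s /[!inE]/= /[!in_itv]/= /andP[s0 _].
    by rewrite /energy_density /phase ger0_norm.
  by rewrite /energy_density /phase normrN ger0_norm// mulrN mulNr.
rewrite (half_wave_energy y a_gt0 if1 n0).
rewrite (half_wave_energy (- y) a_gt0 if1 n0) -EFinD.
rewrite -RintegralD//; try exact: integrable_half_wave_pairing.
congr EFin; apply: eq_Rintegral => t _.
rewrite line_cutE// ReD ImD !mulrDr.
have rearr (p q r s : R) : p + q + (r + s) = p + r + (q + s) by ring.
exact: rearr.
Qed.

Hypothesis f_le1 : \int[mu]_t sqmod (f t) <= 1.

Lemma energy_sqr_le n : 0 <= n -> exists2 X : R,
  (\int[mu]_(t in I) (sqmod (line_cut n t))%:E)%E = X%:E &
  exists2 M : R, (\int[mu]_(xi in `[(- n)%R, n]) (energy_density xi)%:E)%E = M%:E &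
    0 <= M /\ M ^+ 2 <= X.
Proof.
move=> n0.
have [M1 HM1] := half_wave_bounded y a_gt0 if1 n0.
have [M2 HM2] := half_wave_bounded (- y) a_gt0 if1 n0.
have mw1 := cmeasurable_half_wave y a_gt0 if1 I n0.
have mw2 := cmeasurable_half_wave (- y) a_gt0 if1 I n0.
have mI : measurable I by exact: measurable_itv.
have [ic1 ic2] : cintegrable I (line_cut n) /\
    mu.-integrable I (EFin \o (fun t => sqmod (line_cut n t))).
  rewrite line_cutE//; apply: (@bounded_cintegrable _ _ I (M1 + M2)) => //.
  - exact: itvcc_lty.
  - exact: cmeasurableD.
  - move=> t; rewrite ReD (le_trans (ler_normD _ _))// lerD//.
      exact: (HM1 t).1.
    exact: (HM2 t).1.
  - move=> t; rewrite ImD (le_trans (ler_normD _ _))// lerD//.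
      exact: (HM1 t).2.
    exact: (HM2 t).2.
pose X := \int[mu]_(t in I) sqmod (line_cut n t).
pose M := \int[mu]_t (complex.Re (f t) * complex.Re (line_cut n t) +
               complex.Im (f t) * complex.Im (line_cut n t)).
exists X; first by rewrite /X fineK//; apply: integrable_fin_num.
exists M; first exact: energy_pairing.
have M0 : 0 <= M.
  rewrite -lee_fin -energy_pairing//; apply: integral_ge0 => xi _.
  by rewrite lee_fin energy_density_ge0.
split => //.
have X0 : 0 <= X by apply: Rintegral_ge0 => t _; exact: sqmod_ge0.
have if2I : mu.-integrable I (EFin \o (fun t => sqmod (f t))) by exact: integrableS if2.
have ipair : mu.-integrable setT (EFin \o (fun t => complex.Re (f t) * complex.Re (line_cut n t) +
               complex.Im (f t) * complex.Im (line_cut n t))).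
  have rearr (p q r s : R) : p + q + (r + s) = p + r + (q + s) by ring.
  rewrite (_ : (fun t => _) = fun t =>
      (complex.Re (f t) * complex.Re (half_wave a y f n t) +
       complex.Im (f t) * complex.Im (half_wave a y f n t)) +
      (complex.Re (f t) * complex.Re (half_wave a (- y) f n t) +
       complex.Im (f t) * complex.Im (half_wave a (- y) f n t))); last first.
    by apply/funext => t; rewrite line_cutE// ReD ImD !mulrDr; exact: rearr.
  exact: (integrable_EFinD measurableT (integrable_half_wave_pairing y a_gt0 if1 n0 if1)
    (integrable_half_wave_pairing (- y) a_gt0 if1 n0 if1)).
have fI : \int[mu]_(t in I) sqmod (f t) <= 1.
  apply: le_trans f_le1; rewrite Rintegral_mkcond; apply: le_Rintegral => //.
    exact: integrable_restrictT.
  by move=> t _; rewrite patchE; case: ifP => // _; exact: sqmod_ge0.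
(* Cauchy-Schwarz in quadratic form, from the nonnegative integral of |lam f - cut|^2 and ||f|| <=
   1; the value lam = M then gives M^2 <= X. *)
have quad lam : 0 <= lam -> 2 * lam * M <= lam ^+ 2 + X.
  move=> lam0.
  have MI : M = \int[mu]_(t in I) (complex.Re (f t) * complex.Re (line_cut n t) +
               complex.Im (f t) * complex.Im (line_cut n t)).
    rewrite [RHS]Rintegral_mkcond; apply: eq_Rintegral => t _.
    rewrite patchE; case: ifPn => // /negP tI.
    by rewrite f0 ?mul0r ?addr0// => It; apply: tI; rewrite inE.
  have ipI : mu.-integrable I (EFin \o (fun t => complex.Re (f t) * complex.Re (line_cut n t) +
      complex.Im (f t) * complex.Im (line_cut n t))) by exact: integrableS ipair.
  apply: (@le_trans _ _ (lam ^+ 2 * \int[mu]_(t in I) sqmod (f t) + X)); last first.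
    by rewrite lerD2r -[leRHS]mulr1 ler_wpM2l// sqr_ge0.
  rewrite MI -!RintegralZl// -RintegralD//; last exact: integrable_EFinZ.
  apply: le_Rintegral => //.
  - exact: integrable_EFinZ.
  - by apply: integrable_EFinD => //; exact: integrable_EFinZ.
  move=> t _; rewrite /sqmod.
  set p := complex.Re _; set q := complex.Im _; set p' := complex.Re _; set q' := complex.Im _.
  rewrite -subr_ge0.
  have -> : lam ^+ 2 * (p ^+ 2 + q ^+ 2) + (p' ^+ 2 + q' ^+ 2) - 2 * lam * (p * p' + q * q') =
    (lam * p - p') ^+ 2 + (lam * q - q') ^+ 2 by ring.
  by rewrite addr_ge0 ?sqr_ge0.
by have := quad M M0; rewrite -mulrA -expr2; lra.
Qed.

Lemma energy_le_trace v : trace_on_line a u0hat T y v ->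
  (\int[mu]_xi (energy_density xi)%:E <= L2norm I v)%E.
Proof.
move=> [mv cvg0].
have mI : measurable I by exact: measurable_itv.
have L2E (w : R -> R[i]) : L2norm I w = ((\int[mu]_(t in I) (sqmod (w t))%:E) `^ 2^-1)%E.
  by rewrite /L2norm; under eq_integral do rewrite cmodulus_sqr.
have intge0 (w : R -> R[i]) : (0 <= \int[mu]_(t in I) (sqmod (w t))%:E)%E.
  by apply: integral_ge0 => t _; rewrite lee_fin sqmod_ge0.
rewrite L2E; case V_eq : (\int[mu]_(t in I) (sqmod (v t))%:E)%E => [V| |]; last 2 first.
- by rewrite poweRyr ?leey// invr_eq0.
- by have := intge0 v; rewrite V_eq.
have V0 : 0 <= V by rewrite -lee_fin -V_eq.
rewrite poweR_EFin powR12_sqrt//.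
apply: ge0_integralT_le => //.
- exact: measurable_energy_density.
- exact: energy_density_ge0.
move=> n.
have [Xn _ [M ME [M0 _]]] := energy_sqr_le (ler0n R n).
rewrite [X in (X <= _)%E]ME lee_fin -[leLHS]ger0_norm// -sqrtr_sqr ler_wsqrtr//.
apply/ler_addgt0Pr => eps eps0.
(* [(x + y)^2 <= (1 + del) x^2 + (1 + 1 / del) y^2] with [del V <= eps / 2] *)
pose del := eps / (2 * (V + 1)).
have V10 : 0 < V + 1 by rewrite ltr_wpDl.
have del0 : 0 < del by rewrite divr_gt0// mulr_gt0.
pose eta := eps / (2 * (1 + del^-1)).
have del1 : 0 < 1 + del^-1 by rewrite addr_gt0// invr_gt0.
have eta0 : 0 < eta by rewrite divr_gt0// mulr_gt0.
(* The truncation at [n] need not be close to [v]. Since the energy grows with the radius, [M] may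
   be replaced by the energy [M'] at a larger radius where the truncation is close. *)
have [r [rn rD]] : exists r, n%:R <= r /\
    (L2norm I (fun t => line_cut r t - v t)%R < (Num.sqrt eta)%:E)%E.
  have : \forall r \near +oo, n%:R <= r /\
    (L2norm I (fun t => line_cut r t - v t)%R < (Num.sqrt eta)%:E)%E.
    near=> r; split; near: r; first exact: nbhs_pinfty_ge.
    move/fine_cvgP : (cvg0) => [fin c]; near=> r.
    have finr : L2norm I (fun t => line_cut r t - v t) \is a fin_num by near: r.
    rewrite -(fineK finr) lte_fin; near: r.
    by apply: (cvgr_lt 0 c); rewrite sqrtr_gt0.
  by move=> /filter_ex.
have r0 : 0 <= r by apply: le_trans rn.
have [X XE [M' ME' [M'0 M'X]]] := energy_sqr_le r0.
have MM' : M <= M'.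
  rewrite -lee_fin -ME -ME'; apply: ge0_subset_integral => //.
  - by apply/measurable_EFinP; apply: measurable_funTS; exact: measurable_energy_density.
  - by move=> xi _; rewrite lee_fin energy_density_ge0.
  - by apply: subset_itv; rewrite bnd_simp ?lerN2.
have mw1 := cmeasurable_half_wave y a_gt0 if1 I r0.
have mw2 := cmeasurable_half_wave (- y) a_gt0 if1 I r0.
have mcut : cmeasurable I (line_cut r) by rewrite line_cutE//; exact: cmeasurableD.
have D_lt : (\int[mu]_(t in I) (sqmod (line_cut r t - v t))%:E <= eta%:E)%E.
  move: rD; rewrite L2E; have := intge0 (fun t => line_cut r t - v t).
  case: (\int[mu]_(t in I) _)%E => [D| |] // D0; last by rewrite poweRyr// invr_eq0.
  rewrite lee_fin in D0.
  by rewrite poweR_EFin powR12_sqrt// lte_fin ltr_sqrt// lee_fin => /ltW.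
have X_le : X <= (1 + del) * V + (1 + del^-1) * eta.
  rewrite -lee_fin -XE EFinD !EFinM -V_eq.
  have g1 : 0 <= 1 + del by rewrite addr_ge0// ltW.
  apply: (@le_trans _ _ ((1 + del)%:E * \int[mu]_(t in I) (sqmod (v t))%:E +
     (1 + del^-1)%:E * \int[mu]_(t in I) (sqmod (line_cut r t - v t))%:E)%E); last first.
    by apply: leeD => //; apply: lee_wpmul2l => //; rewrite lee_fin ltW.
  have mV : measurable_fun I (fun t => (sqmod (v t))%:E) by exact: measurable_EFin_sqmod.
  have mD : measurable_fun I (fun t => (sqmod (line_cut r t - v t))%:E).
    by apply: measurable_EFin_sqmod; exact: cmeasurableB.
  rewrite -!ge0_integralZl_EFin//; try by move=> t _; rewrite lee_fin sqmod_ge0.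
    rewrite -ge0_integralD//; last 4 first.
    - by move=> t _; rewrite mule_ge0// lee_fin sqmod_ge0.
    - by apply: emeasurable_funM.
    - by move=> t _; rewrite mule_ge0// lee_fin ?sqmod_ge0 ?ltW.
    - by apply: emeasurable_funM.
    apply: ge0_le_integral => //.
    - by move=> t _; rewrite lee_fin sqmod_ge0.
    - exact: measurable_EFin_sqmod.
    - by apply: emeasurable_funD; apply: emeasurable_funM.
    move=> t _; rewrite -!EFinM -EFinD lee_fin /sqmod ReB ImB.
    set p := complex.Re _; set q := complex.Im _; set p' := complex.Re _; set q' := complex.Im _.
    rewrite -subr_ge0.
    have -> : (1 + del) * (p' ^+ 2 + q' ^+ 2) + (1 + del^-1) * ((p - p') ^+ 2 + (q - q') ^+ 2) -
        (p ^+ 2 + q ^+ 2) = del^-1 * ((p - p' - del * p') ^+ 2 + (q - q' - del * q') ^+ 2).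
      by field; exact: lt0r_neq0.
    by rewrite mulr_ge0 ?invr_ge0 ?(ltW del0)// addr_ge0 ?sqr_ge0.
  by rewrite ltW.
apply: (@le_trans _ _ (M' ^+ 2)); first by rewrite ler_sqr ?nnegrE.
apply: (le_trans M'X); apply: (le_trans X_le).
have -> : (1 + del^-1) * eta = eps / 2.
  by rewrite /eta; move: (1 + del^-1) del1 => q q0; field; exact: lt0r_neq0.
have : del * V <= eps / 2.
  have -> : eps / 2 = del * (V + 1) by rewrite /del; field; rewrite lt0r_neq0.
  by rewrite ler_pM2l// lerDl.
lra.
Unshelve. all: by end_near. Qed.

End propagator.

(** * The window and the concentration functional *)

Section window.
Context (R : realType).
Notation mu := (@lebesgue_measure R).
Variables (T : R) (g : R -> R[i]) (phi : R -> R).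
Let I : set R := `[T, 2 * T]%classic.
Hypothesis mg : cmeasurable setT g.
Hypothesis g1 : L2norm setT g = 1%E.
Hypothesis tphi : test_function phi.
Hypothesis phi_ge0 : forall t, 0 <= phi t.
Hypothesis phi_le : forall t, phi t ^+ 2 <= \1_I t.

Let f t := g t * real_complex R (phi t).

Let fE t : f t = real_complex R (phi t) * g t. Proof. by rewrite /f mulrC. Qed.

Let mphi : measurable_fun setT phi.
Proof.
apply: continuous_measurable_fun => x; apply/differentiable_continuous/derivable1_diffP.
by have [/(_ 0%N x)] := tphi.
Qed.

Lemma window_supp t : ~ I t -> f t = 0.
Proof.
move=> It; have := phi_le t; rewrite indicE memNset// => H.
have /eqP : phi t ^+ 2 = 0 by apply/eqP; rewrite eq_le H sqr_ge0.
by rewrite sqrf_eq0 /f => /eqP ->; rewrite mulr0.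
Qed.

Let int_g : (\int[mu]_t (sqmod (g t))%:E)%E = 1%E.
Proof.
move: g1; rewrite /L2norm; under eq_integral do rewrite cmodulus_sqr.
have : (0 <= \int[mu]_t (sqmod (g t))%:E)%E.
  by apply: integral_ge0 => t _; rewrite lee_fin sqmod_ge0.
case: (\int[mu]_t (sqmod (g t))%:E)%E => [r| |] //; last by rewrite poweRyr// invr_eq0.
rewrite lee_fin => r0; rewrite poweR_EFin powR12_sqrt// => -[] r1.
by rewrite -(sqr_sqrtr r0) r1 expr1n.
Qed.

Let sqmod_f t : sqmod (f t) = phi t ^+ 2 * sqmod (g t).
Proof. by rewrite fE sqmod_real_complexM. Qed.

Let sqmod_f_le t : sqmod (f t) <= sqmod (g t).
Proof.
rewrite sqmod_f -[leRHS]mul1r ler_wpM2r ?sqmod_ge0//.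
by apply: le_trans (phi_le t) _; rewrite indicE; case: (_ \in _).
Qed.

Lemma cmeasurable_window : cmeasurable setT f.
Proof.
case: mg => m1 m2; split.
- by under eq_fun do rewrite fE Re_real_complexM; exact: measurable_funM.
- by under eq_fun do rewrite fE Im_real_complexM; exact: measurable_funM.
Qed.

Let ig : mu.-integrable setT (EFin \o (fun t => sqmod (g t))).
Proof.
apply/integrableP; split; first exact: measurable_EFin_sqmod.
under eq_integral do rewrite /= ger0_norm ?sqmod_ge0//.
by rewrite int_g ltry.
Qed.

Lemma integrable_sqmod_window : mu.-integrable setT (EFin \o (fun t => sqmod (f t))).
Proof.
apply: (le_integrable measurableT _ _ ig).
  exact: (measurable_EFin_sqmod cmeasurable_window).
by move=> t _; rewrite /= lee_fin !ger0_norm ?sqmod_ge0.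
Qed.

Lemma sqmod_window_le1 : \int[mu]_t sqmod (f t) <= 1.
Proof.
rewrite -lee_fin fineK; last exact: (integrable_fin_num _ integrable_sqmod_window).
rewrite -int_g; apply: ge0_le_integral => //.
- by move=> t _; rewrite lee_fin sqmod_ge0.
- exact: (measurable_EFin_sqmod cmeasurable_window).
- exact: measurable_EFin_sqmod.
- by move=> t _; rewrite lee_fin.
Qed.

(** Square integrability on a bounded interval gives integrability, through |x| <= 1 + x^2 on the
    support. *)
Lemma cintegrable_window : cintegrable setT f.
Proof.
have iI : mu.-integrable setT (EFin \o (fun t => \1_I t + sqmod (f t))).
  apply: integrable_EFinD => //; last exact: integrable_sqmod_window.
  exact: integrable_indic_itv.
have le_abs (x : R) : `|x| <= 1 + x ^+ 2.
  rewrite -(real_normK (num_real x)); set z := `|x|.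
  rewrite -subr_ge0; have -> : 1 + z ^+ 2 - z = (z - 2^-1) ^+ 2 + 3 / 4 by field.
  by rewrite addr_ge0 ?sqr_ge0.
have bound (h : R -> R) : (forall t, h t ^+ 2 <= sqmod (f t)) ->
    (forall t, ~ I t -> h t = 0) -> forall t, `|h t| <= `|\1_I t + sqmod (f t)|.
  move=> hf h0 t.
  have rhs0 : 0 <= \1_I t + sqmod (f t) by rewrite addr_ge0 ?sqmod_ge0// indicE.
  rewrite (ger0_norm rhs0).
  have [It|It] := pselect (I t).
    by rewrite indicE mem_set//= (le_trans (le_abs _))// lerD2l.
  by rewrite h0// normr0 indicE memNset// add0r sqmod_ge0.
have [m1 m2] := cmeasurable_window.
split; apply: (le_integrable measurableT _ _ iI).
- exact/measurable_EFinP.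
- move=> t _; rewrite /= lee_fin; apply: (bound (fun t => complex.Re (f t))) => [u|u It].
    by rewrite /sqmod lerDl sqr_ge0.
  by rewrite window_supp.
- exact/measurable_EFinP.
- move=> t _; rewrite /= lee_fin; apply: (bound (fun t => complex.Im (f t))) => [u|u It].
    by rewrite /sqmod lerDr sqr_ge0.
  by rewrite window_supp.
Qed.

End window.

Section concentration.
Context (R : realType).
Notation mu := (@lebesgue_measure R).
Variables (a y : R) (f : R -> R[i]).
Hypothesis a_gt0 : 0 < a.
Hypothesis a_neq1 : a != 1.
Hypothesis y_neq0 : y != 0.
Hypothesis if1 : cintegrable setT f.
Let Z := (a - 1) * (`|y| / a) `^ (a / (a - 1)).

(** The two branches become one formula: for a < 1 the number [Z] is negative, and reflection
    carries [Z, 0] to [0, |Z|], which is the range of the shifted phase [z]. *)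
Lemma Cg_sqE : Cg_sq a y f =
  (\int[mu]_(x in `[0%R, `|Z|%R]) (x `^ (- 2^-1) * sqmod (fourier f (Num.sg (a - 1) * x - Z)%R))%:E)%E.
Proof.
have yaE : `|y / a| = `|y| / a by rewrite normrM normfV (gtr0_norm a_gt0).
have q_gt0 : 0 < (`|y| / a) `^ (a / (a - 1)) by rewrite powR_gt0// divr_gt0// normr_gt0.
rewrite /Cg_sq yaE -/Z.
case: ifPn => [a1|].
  have Z0 : 0 < Z by rewrite mulr_gt0// subr_gt0.
  rewrite (gtr0_norm Z0) gtr0_sg ?subr_gt0//.
  apply: eq_integral => x; rewrite inE => xI.
  have x0 : 0 <= x by move: xI; rewrite /= in_itv/= => /andP[].
  by rewrite ger0_norm// cmodulus_sqr mul1r.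
rewrite -leNgt => a1.
have a_lt1 : a < 1 by rewrite lt_neqAle a_neq1.
have Z0 : Z < 0 by rewrite /Z nmulr_rlt0// subr_lt0.
rewrite (ltr0_norm Z0) ltr0_sg ?subr_lt0//.
have mF : measurable_fun setT (fun tau => sqmod (fourier f tau)).
  by apply: continuous_measurable_fun; exact: continuous_sqmod_fourier.
pose h z := `|z| `^ (- 2^-1) * sqmod (fourier f (z - Z)).
have mh : measurable_fun setT h.
  apply: measurable_funM; first exact: (measurableT_comp (measurable_powR _)).
  by apply: (measurableT_comp mF); exact: measurable_funB.
have h0 z : (0 <= (h z)%:E)%E by rewrite lee_fin mulr_ge0 ?powR_ge0 ?sqmod_ge0.
have mEh : measurable_fun setT (EFin \o h) by exact/measurable_EFinP.
transitivity (\int[mu]_(z in `[(- - Z)%R, 0%R]) (EFin \o h) z)%E.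
  rewrite opprK; apply: eq_integral => z _; rewrite cmodulus_sqr; congr EFin.
  by congr (_ * sqmod (fourier f _)); rewrite /Z; ring.
rewrite (ge0_integral_itv_opp (- Z) mEh h0).
apply: eq_integral => x; rewrite inE => xI.
have x0 : 0 <= x by move: xI; rewrite /= in_itv/= => /andP[].
by rewrite /= /h normrN ger0_norm// mulN1r.
Qed.

Lemma Cg_sq_le_energy :
  ((Num.min 1 a^-1 / Num.sqrt (2 * `|a - 1| * Num.max 1 a^-1) *
    a^-1 `^ (a / (2 * (a - 1))) * `|y| `^ (a / (2 * (a - 1))))%:E * Cg_sq a y f <=
   \int[mu]_xi (energy_density a y f xi)%:E)%E.
Proof.
have ny0 : 0 < `|y| by rewrite normr_gt0.
have cF := continuous_sqmod_fourier if1.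
rewrite Cg_sqE.
apply: (le_trans (phase_energy_lower_bound a_gt0 a_neq1 ny0 cF (fun _ => sqmod_ge0 _))).
set s1 := `|y| `^ (a - 1)^-1.
have mE := measurable_energy_density a y if1.
have mEE : measurable_fun setT (EFin \o energy_density a y f) by exact/measurable_EFinP.
have E0 xi : (0 <= (energy_density a y f xi)%:E)%E by rewrite lee_fin energy_density_ge0.
have sub (D : set R) : measurable D ->
    (\int[mu]_(xi in D) (energy_density a y f xi)%:E <=
     \int[mu]_xi (energy_density a y f xi)%:E)%E.
  by move=> mD; apply: ge0_subset_integral.
(* The critical point lies at positive frequency when y < 0 and at negative frequency when y > 0;
   the energy of the other half-line is dropped. *)
move: y_neq0; rewrite neq_lt => /orP[] y0.
- have nyE : - `|y| = y by rewrite (ltr0_norm y0) opprK.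
  rewrite nyE.
  have := sub `[0, s1]%classic (measurable_itv _); apply: le_trans.
  rewrite le_eqVlt; apply/orP; left; apply/eqP.
  apply: eq_integral => s; rewrite inE => sI.
  have s0 : 0 <= s by move: sI; rewrite /= in_itv/= => /andP[].
  by rewrite /energy_density /phase ger0_norm.
- have nyE : - `|y| = - y by rewrite (gtr0_norm y0).
  rewrite nyE.
  have := sub `[- s1, 0]%classic (measurable_itv _).
  rewrite (ge0_integral_itv_opp s1 mEE E0); apply: le_trans.
  rewrite le_eqVlt; apply/orP; left; apply/eqP.
  apply: eq_integral => s; rewrite inE => sI.
  have s0 : 0 <= s by move: sI; rewrite /= in_itv/= => /andP[].
  by rewrite /= /energy_density /phase normrN ger0_norm// mulrN mulNr.
Qed.

End concentration.

Theorem theorem3p3 (R : realType) (a : R) (a_gt0 : 0 < a) (a_neq1 : a != 1) :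
  exists C' : R, 0 < C' /\
  forall (T y : R) (g : R -> R[i]) (phi : R -> R) (u0hat : R -> R[i]),
    0 < T -> y != 0 ->
    cmeasurable setT g -> L2norm setT g = 1%E ->
    test_function phi ->
    (forall t, 0 <= phi t) ->
    (forall t, phi t ^+ 2 <= \1_(`[T, 2 * T]) t) ->
    (forall xi, u0hat xi =
      real_complex R (`|xi| `^ (a - 1)) *
      fourier (fun t => g t * real_complex R (phi t)) (y * xi + `|xi| `^ a)) ->
    (exists v, trace_on_line a u0hat T y v) /\
    (forall v, trace_on_line a u0hat T y v ->
      ((C' * `|y| `^ (a / (4 * (a - 1))))%:E *
         Cg a y (fun t => g t * real_complex R (phi t))%R *
         hdot_norm ((1 - a) / 2) u0hat <= L2norm `[T, (2 * T)%R] v)%E).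
Proof.
(* The constant of [Cg_sq_le_energy] without its power of |y|. That estimate concerns squares, hence
   the square root in the witness. *)
pose Kc := Num.min 1 a^-1 / Num.sqrt (2 * `|a - 1| * Num.max 1 a^-1) *
  a^-1 `^ (a / (2 * (a - 1))).
have Kc_gt0 : 0 < Kc.
  have na1 : 0 < `|a - 1| by rewrite normr_gt0 subr_eq0.
  have ia : 0 < a^-1 by rewrite invr_gt0.
  apply: mulr_gt0; last exact: powR_gt0.
  apply: divr_gt0; first by rewrite lt_min ltr01.
  by rewrite sqrtr_gt0 !mulr_gt0// lt_max ltr01.
exists (Num.sqrt Kc); split; first by rewrite sqrtr_gt0.
move=> T y g phi u0hat T_gt0 y_neq0 mg g1 tphi phi_ge0 phi_le u0hatE.
set f := fun t => g t * real_complex R (phi t).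
have f0 := window_supp g phi_le.
have if1 := cintegrable_window mg g1 tphi phi_le.
have if2 := integrable_sqmod_window mg g1 tphi phi_le.
have f_le1 := sqmod_window_le1 mg g1 tphi phi_le.
split; first exact: (trace_on_line_exists a_gt0 a_neq1 y_neq0 T_gt0 f0 if1 if2 u0hatE).
move=> v vP.
have energy_le := energy_le_trace a_gt0 f0 if1 if2 u0hatE f_le1 vP.
have Cg_le := Cg_sq_le_energy a_gt0 a_neq1 y_neq0 if1.
rewrite (hdot_norm_energy a_neq1 u0hatE).
set H := (X in (X `^ 2^-1)%E) in energy_le Cg_le *.
have H0 : (0 <= H)%E.
  by apply: integral_ge0 => xi _; rewrite lee_fin energy_density_ge0.
(* The trace dominates the energy [H] itself. One of its square roots matches the Sobolev norm, and
   the other remains to be compared with the factor containing [Cg]; the splitting also holds if [H]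
   is infinite. *)
have HE : (H `^ 2^-1 * H `^ 2^-1)%E = H.
  case: H H0 {Cg_le energy_le} => [h| |] // h0; last by rewrite poweRyr ?invr_eq0// mulyy.
  rewrite lee_fin in h0.
  by rewrite poweR_EFin powR12_sqrt// -EFinM -expr2 sqr_sqrtr.
apply: le_trans energy_le; rewrite -[X in (_ <= X)%E]/H -[X in (_ <= X)%E]HE.
apply: lee_wpmul2r; first exact: poweR_ge0.
have Cg0 : (0 <= Cg_sq a y f)%E.
  rewrite (Cg_sqE a_gt0 a_neq1 y_neq0 if1); apply: integral_ge0 => x _.
  by rewrite lee_fin mulr_ge0 ?powR_ge0 ?sqmod_ge0.
set c := (_ * `|y| `^ (a / (2 * (a - 1))))%R in Cg_le.
have c0 : 0 <= c by rewrite mulr_ge0 ?powR_ge0// ltW.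
have -> : Num.sqrt Kc * `|y| `^ (a / (4 * (a - 1))) = c `^ 2^-1.
  rewrite /c powRM ?powR_ge0 ?(ltW Kc_gt0)// powR12_sqrt ?(ltW Kc_gt0)//; congr (_ * _).
  rewrite -powRrM; congr (_ `^ _); rewrite !invfM -!mulrA; congr (_ * _).
  have -> : (4 : R)^-1 = 2^-1 * 2^-1 by field.
  ring.
rewrite /Cg -poweR_EFin -poweRM ?lee_fin//.
apply: gt0_ler_poweR; rewrite ?invr_ge0// in_itv/= leey andbT//.
by rewrite mule_ge0 ?lee_fin.
Qed.
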